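(* Let $n$ be an even positive integer, let $K$ be a field of characteristic different from $2$ containing a primitive $n$-th root of unity $\omega$, let $a,b\in K^{\times}$, let $S=(a,b;n,K,\omega)$ be the corresponding symbol algebra, and let $T_S$ be its quadratic trace form. Write $T_S\simeq q_S\perp m\times\mathbb{H}$ where $q_S\simeq\langle n\rangle\langle 1,a,b,(-1)^{\frac n2}ab\rangle$ and $m=\frac{n^2-4}{2}$. Let $k$ be an odd integer with $k>1$. Then $$S^kT_S\simeq\begin{cases}\displaystyle\frac{2m+2k+4}{k-1}\binom{(2m+k+3)/2}{(k-3)/2}\times q_S\perp\mathrm{Hyp},&\text{if }n\equiv 0\pmod 4;\\[3mm]\displaystyle\frac{2m+6}{k-1}\binom{(2m+k+3)/2}{(k-3)/2}\times q_S\perp\mathrm{Hyp},&\text{if }n\equiv 2\pmod 4.\end{cases}$$ Here $\mathrm{Hyp}$ denotes the orthogonal sum of the number of hyperbolic planes needed for the right-hand side to have dimension $\dim S^kT_S=\binom{n^2+k-1}{k}$.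
   Context: $K$ is a field with $\mathrm{char}(K)\neq 2$, and symmetric bilinear forms over $K$ are identified with quadratic forms. $\langle a_1,\dots,a_m\rangle$ denotes the diagonal form with coefficients $a_i\in K^{\times}$. $\mathbb{H}=\langle 1,-1\rangle$ is the hyperbolic plane. For $r\ge 0$, $r\times\varphi$ denotes the orthogonal sum of $r$ copies of $\varphi$, whereas $\langle n\rangle\varphi$ denotes the tensor product of the one-dimensional form $\langle n\rangle$ with $\varphi$ (scaling by $n$). $\perp$ denotes orthogonal sum and $\simeq$ denotes isometry. (Non-factorial) symmetric power: for $\varphi\simeq\langle a_1,\dots,a_m\rangle$ and an integer $k\ge 0$, the $k$-fold symmetric power $S^k\varphi$ is the diagonal form on the $k$-th symmetric power $S^kV$ of the underlying space $V$ given by the orthogonal sum of the one-dimensional forms $\langle a_{i_1}^{k_{i_1}}\cdots a_{i_\ell}^{k_{i_\ell}}\rangle$ over all choices of indices $1\le i_1<\dots<i_\ell\le m$ and positive integers $k_{i_1},\dots,k_{i_\ell}$ with $k_{i_1}+\dots+k_{i_\ell}=k$. That is, there is one summand for each degree-$k$ monomial in $a_1,\dots,a_m$. In particular $S^0\varphi=\langle 1\rangle$, $S^1\varphi=\varphi$ and $\dim S^k\varphi=\binom{m+k-1}{k}$. Up to isometry $S^k\varphi$ depends only on the isometry class of $\varphi$. (In this paragraph $m$ denotes the dimension of $\varphi$, and is unrelated to the $m$ of the claim.) Symbol algebra: for $a,b\in K^{\times}$ and a primitive $n$-th root of unity $\omega\in K$, $(a,b;n,K,\omega)$ is the $K$-algebra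 generated by elements $x,y$ with $x^n=a$, $y^n=b$, $yx=\omega xy$. It is a central simple $K$-algebra of degree $n$ (dimension $n^2$). Trace form: for a central simple $K$-algebra $A$, $T_A\colon A\to K$ is the quadratic form $T_A(z)=\mathrm{Trd}_A(z^2)$, where $\mathrm{Trd}_A$ is the reduced trace of $A$. For $n$ even it is a known result that $T_S\simeq\langle n\rangle\langle 1,a,b,(-1)^{n/2}ab\rangle\perp\frac{n^2-4}{2}\times\mathbb{H}$. *)

(* Defs.v *)
From HB Require Import structures.
From mathcomp Require Import all_boot all_order all_algebra all_field.
From mathcomp Require Import ring.

Set Implicit Arguments.
Unset Strict Implicit.
Unset Printing Implicit Defensive.

Import GRing.Theory.
Local Open Scope ring_scope.

Section QuadraticForms.
Variable K : fieldType.

(* As 2 is invertible in all uses, symmetric bilinear forms are identified with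
   their quadratic forms, and a form is a function from a vector space to K. *)
Definition isometric (V W : vectType K) (p : V -> K) (q : W -> K) : Prop :=
  exists f : {linear V -> W}, bijective f /\ forall v, q (f v) = p v.

(* The form <s_0, ..., s_(N-1)>.  The orthogonal sum of two diagonal forms is
   the concatenation s ++ t of their coefficient sequences. *)
Definition diag_form (s : seq K) (v : 'rV[K]_(size s)) : K :=
  \sum_(i < size s) s`_i * v 0 i ^+ 2.

(* <c> s, as opposed to the r-fold orthogonal sum r x s. *)
Definition dscale (c : K) (s : seq K) : seq K := [seq c * x | x <- s].
Definition dcopies (r : nat) (s : seq K) : seq K := flatten (nseq r s).

Definition hyperbolic_plane : seq K := [:: 1; -1].

(* One coefficient for each monomial of degree k in the entries of s; the tuple
   t is the exponent vector, with 0 at the indices that are not chosen. *)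
Definition dsym_power (k : nat) (s : seq K) : seq K :=
  let N := size s in
  [seq \prod_(i < N) s`_i ^+ tnth t i
    | t : N.-tuple 'I_k.+1
        in [set t : N.-tuple 'I_k.+1 | (\sum_(i <- t) i == k)%N]].

Lemma size_dsym_power k s : (0 < size s)%N ->
  size (dsym_power k s) = 'C(size s + k - 1, k).
Proof.
rewrite /dsym_power size_map -cardE.
case: (size s) => // N _; rewrite card_ord_partitions addSn subn1 /=.
by rewrite -[RHS]bin_sub ?leq_addl // addnK.
Qed.

(* psi is (a representative of the isometry class of) S^k phi *)
Definition is_sym_power (k : nat) (V W : vectType K) (phi : V -> K)
    (psi : W -> K) : Prop :=
  exists s : seq K, [/\ all (fun c => c != 0) s,
    isometric phi (@diag_form s) & isometric psi (@diag_form (dsym_power k s))].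

End QuadraticForms.

Section Algebras.
Variable K : fieldType.

(* S is the symbol algebra (a, b; n, K, w).  When w is a primitive n-th root of
   unity and a, b are nonzero, the algebra presented by these generators and
   relations is simple, so the nonzero algebra S is not a proper quotient. *)
Definition is_symbol_algebra (a b : K) (n : nat) (w : K) (S : falgType K) :
    Prop :=
  exists x y : S, [/\ x ^+ n = a%:A, y ^+ n = b%:A, y * x = w *: (x * y)
    & agenv <<[:: x; y]>> = fullv].

(* For a field extension iota of K, phi : A -> M_d(L) is a homomorphism of
   K-algebras whose L-linear extension to the tensor product of A and L is an
   isomorphism: it sends a K-basis of A to an L-basis of M_d(L). *)
Definition is_splitting (A : falgType K) (L : fieldType)
    (iota : {rmorphism K -> L}) (d : nat) (phi : {rmorphism A -> 'M[L]_d}) :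
    Prop :=
  (forall c z, phi (c *: z) = iota c *: phi z) /\
  basis_of fullv [seq phi z | z <- vbasis {:A}].

(* Reduced traces do not depend on the splitting used to compute them. *)
Definition is_reduced_trace (A : falgType K) (Trd : A -> K) : Prop :=
  exists (L : fieldType) (iota : {rmorphism K -> L}) (d : nat)
         (phi : {rmorphism A -> 'M[L]_d}),
    is_splitting iota phi /\ forall z, iota (Trd z) = \tr (phi z).

Definition trace_form (A : falgType K) (Trd : A -> K) (z : A) : K :=
  Trd (z ^+ 2).

End Algebras.

(* The rational number r / (k - 1) * C((2m + k + 3) / 2, (k - 3) / 2); the lemmas
   below show that the divisions are exact for the two relevant values of r. *)
Definition mult_coef (r m k : nat) : nat :=
  ((r * 'C((2 * m + k + 3)./2, (k - 3)./2)) %/ (k - 1))%N.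

Lemma mult_coef_dvd2 (m k : nat) : odd k -> (1 < k)%N ->
  (k - 1 %| (2 * m + 6) * 'C((2 * m + k + 3)./2, (k - 3)./2))%N.
Proof.
move=> k_odd k_gt1.
have [j ->] : exists j, k = j.+1.*2.+1.
  exists k./2.-1; rewrite prednK; last by rewrite half_gt0.
  by rewrite -[LHS]odd_double_half k_odd.
have -> : ((j.+1.*2.+1 - 3)./2 = j)%N by rewrite doubleS !subSS subn0 doubleK.
have -> : ((2 * m + j.+1.*2.+1 + 3)./2 = m + j + 3)%N.
  rewrite (_ : (2 * m + j.+1.*2.+1 + 3 = (m + j + 3).*2)%N) ?doubleK //.
  by rewrite -!muln2; ring.
rewrite subn1 /=.
have := mul_bin_left (m + j + 3) j.
rewrite (_ : (m + j + 3 - j = m + 3)%N); last by rewrite addnAC addnK.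
move=> E.
rewrite (_ : (2 * m + 6 = (m + 3) * 2)%N); last by rewrite mulnDl mulnC.
by rewrite mulnAC -E mulnAC -muln2 dvdn_mulr.
Qed.

Lemma mult_coef_dvd0 (m k : nat) : odd k -> (1 < k)%N ->
  (k - 1 %| (2 * m + 2 * k + 4) * 'C((2 * m + k + 3)./2, (k - 3)./2))%N.
Proof.
move=> k_odd k_gt1.
rewrite (_ : (2 * m + 2 * k + 4 = (2 * m + 6) + 2 * (k - 1))%N).
  by rewrite mulnDl dvdn_addr ?mult_coef_dvd2 // mulnAC dvdn_mull.
by case: k k_gt1 {k_odd} => // k _; rewrite subn1 /=; ring.
Qed.

(* Main.v *)
Require Import Defs.
From HB Require Import structures.
From mathcomp Require Import all_boot all_order all_algebra all_field.
From mathcomp Require Import ring zify.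
From Stdlib Require Import Setoid.

Set Implicit Arguments.
Unset Strict Implicit.
Unset Printing Implicit Defensive.

Import GRing.Theory.
Local Open Scope ring_scope.

(** Two things have to be established: a diagonalization of the trace form,
    and the independence of the symmetric power from the diagonalization,
    since the symmetric power is computed from an arbitrary one.

    The trace form. Conjugation by x and y scales the monomials x^i y^j by
    powers of w and preserves the reduced trace, so the trace vanishes on all
    monomials but the scalar ones ([Trd_mon0]). Hence x^i y^j pairs
    nontrivially with x^(-i) y^(-j) only, exponents modulo n. The monomials 1,
    x^(n/2), y^(n/2) and x^(n/2) y^(n/2), which are paired with themselves,
    span q, and the other n^2 - 4 monomials span (n^2 - 4) / 2 hyperbolic
    planes ([symbol_orth]). The trace of 1 is the degree of the splitting,
    which is n because the dimension of the algebra is n^2 ([symbol_dim]).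

    Independence. Two orthogonal bases of a quadratic space are linked by a
    chain of orthogonal bases in which consecutive ones differ in at most two
    vectors ([chain_of_orth]). It therefore suffices that the symmetric power
    respects a change of two entries, which follows from the recursion of the
    complete symmetric functions ([sympow_chain]).

    The computation. Put together in a generating function with variable t,
    the symmetric powers of <a> form 1 / (1 - a t) = (1 + a t) / (1 - t^2)
    modulo squares, and those of a hyperbolic plane form 1 / (1 - t^2) modulo
    hyperbolic planes. The entries of q have product e = (-1)^(n/2) modulo
    squares, so the odd part of the product of the 1 + c t over the entries c
    of q is q t + e q t^3, and the symmetric powers of q + m H in odd degrees
    are the coefficients of (q t + e q t^3) / (1 - t^2)^(m + 4)
    ([sympow_quaternionic]). In degree k these are binomial multiples of q and
    of e q, which add up when e = 1 and cancel in part when e = -1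
    ([sympow_odd_plus], [sympow_odd_minus]). Since hyperbolic planes are only
    ever split off, the result is an isometry and not just an equality of Witt
    classes. *)

(** * Chains of elementary isometries between diagonal forms *)

Reserved Notation "s ~~> t" (at level 70, no associativity).

Section Chains.
Variable K : fieldType.
Implicit Types (s t u : seq K) (a b c x y : K).

(** The elementary moves of the chain equivalence theorem: rescaling an entry by
    a square, exchanging neighbours, and replacing two entries a, b by a value c
    that the plane represents together with the complement dictated by the
    determinant.  A construction on diagonal forms respects isometries as soon
    as it respects these moves. *)
Inductive chain : seq K -> seq K -> Prop :=
| ChainRefl s : s ~~> s
| ChainTrans s t u : s ~~> t -> t ~~> u -> s ~~> u
| ChainCons a c s t : c != 0 -> s ~~> t -> a * c ^+ 2 :: s ~~> a :: t
| ChainSwap a b s : [:: a, b & s] ~~> [:: b, a & s]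
| ChainPair a b c x y s :
    a != 0 -> b != 0 -> c = a * x ^+ 2 + b * y ^+ 2 -> c != 0 ->
    [:: a, b & s] ~~> [:: c, a * b * c & s]
where "s ~~> t" := (chain s t).

#[global] Instance chain_preorder : PreOrder chain.
Proof. by split; [exact: ChainRefl | exact: ChainTrans]. Qed.

Lemma chain_cons a s t : s ~~> t -> a :: s ~~> a :: t.
Proof. by move/(ChainCons a (oner_neq0 K)); rewrite expr1n mulr1. Qed.

Lemma chain_sq a c s : c != 0 -> a * c ^+ 2 :: s ~~> a :: s.
Proof. by move/ChainCons; apply; exact: ChainRefl. Qed.

Lemma chain_catl u s t : s ~~> t -> u ++ s ~~> u ++ t.
Proof. by move=> st; elim: u => //= a u; apply: chain_cons. Qed.

Lemma chain_perm s t : perm_eq s t -> s ~~> t.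
Proof.
elim: s t => [|a s IHs] t st.
  by move/perm_size: st => /esym/size0nil->; exact: ChainRefl.
have at_ : a \in t by rewrite -(perm_mem st) mem_head.
case/splitPr: at_ st => t1 t2; rewrite perm_sym -cat1s perm_catCA /= perm_cons.
rewrite perm_sym => /IHs/(chain_cons a) st.
apply: (ChainTrans st) => {s IHs st}.
elim: t1 => [|b t1 IHt] /=; first exact: ChainRefl.
by apply: ChainTrans (chain_cons b IHt); apply: ChainSwap.
Qed.

Lemma chain_cat s s' t t' : s ~~> s' -> t ~~> t' -> s ++ t ~~> s' ++ t'.
Proof.
move=> ss' tt'; apply: ChainTrans (chain_catl s tt') _.
apply: ChainTrans (chain_perm _) _; first by rewrite perm_catC.
apply: ChainTrans (chain_catl t' ss') _.
by apply: chain_perm; rewrite perm_catC.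
Qed.

Lemma chain_size s t : s ~~> t -> size s = size t.
Proof. by elim=> //= [s1 s2 s3 _ -> | a c s1 s2 _ _ ->]. Qed.

Lemma isometric_trans (U V W : vectType K) (p : U -> K) (q : V -> K)
    (r : W -> K) : isometric p q -> isometric q r -> isometric p r.
Proof.
case=> f [f_bij fP] [g [g_bij gP]]; exists (g \o f); split=> [|v /=].
  exact: bij_comp.
by rewrite gP fP.
Qed.

Lemma isometric_refl (V : vectType K) (p : V -> K) : isometric p p.
Proof. by exists (idfun : {linear V -> V}); split=> //; exists id. Qed.

Lemma diag_form_cons a s (v : 'rV_(1 + size s)) :
  diag_form (s := a :: s) v =
  a * v 0 (lshift _ 0) ^+ 2 + diag_form (rsubmx v).
Proof.
rewrite /diag_form big_ord_recl; congr (_ * v _ _ ^+ 2 + _).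
  exact: val_inj.
by apply: eq_bigr => i _; rewrite mxE; congr (_ * v _ _ ^+ 2); apply: val_inj.
Qed.

Lemma isometric_cons a c s t : c != 0 ->
  isometric (@diag_form K s) (@diag_form K t) ->
  isometric (@diag_form K (a * c ^+ 2 :: s)) (@diag_form K (a :: t)).
Proof.
move=> c0 [f [[g fK gK] fP]].
pose F (v : 'rV[K]_(1 + size s)) : 'rV_(1 + size t) :=
  row_mx (c *: lsubmx v) (f (rsubmx v)).
have F_lin : linear F.
  move=> k u v; rewrite /F scale_row_mx add_row_mx.
  have -> : lsubmx (k *: u + v) = k *: lsubmx u + lsubmx v by rewrite linearP.
  have -> : rsubmx (k *: u + v) = k *: rsubmx u + rsubmx v by rewrite linearP.
  by rewrite (linearP f) scalerDr !scalerA [c * k]mulrC.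
pose FL := GRing.isLinear.Build _ _ _ _ F F_lin.
pose F' : {linear 'rV_(size (a * c ^+ 2 :: s)) -> 'rV_(size (a :: t))} :=
  HB.pack F FL.
exists F'; split.
  exists (fun v : 'rV_(1 + size t) =>
    row_mx (c^-1 *: lsubmx v) (g (rsubmx v)) : 'rV_(1 + size s)) => v.
    by rewrite /= /F row_mxKl row_mxKr fK scalerA mulVf // scale1r hsubmxK.
  by rewrite /= /F row_mxKl row_mxKr gK scalerA mulfV // scale1r hsubmxK.
move=> v; rewrite (diag_form_cons a (F v)) (diag_form_cons _ v) /F.
by rewrite row_mxKr fP row_mxEl !mxE exprMn mulrA.
Qed.

Definition head2 N (p q r z : K) (v : 'rV[K]_N.+2) : 'rV[K]_N.+2 :=
  \row_j (if (j == 0 :> nat) then p * v 0 0 + q * v 0 1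
          else if (j == 1 :> nat) then r * v 0 0 + z * v 0 1 else v 0 j).

Lemma head2_linear N p q r z : linear (@head2 N p q r z).
Proof.
move=> k u v; apply/rowP=> j; rewrite !mxE.
by do 2?case: ifP => _ //; ring.
Qed.

Lemma head2_comp N p q r z p' q' r' z' (v : 'rV[K]_N.+2) :
  p' * p + q' * r = 1 -> p' * q + q' * z = 0 ->
  r' * p + z' * r = 0 -> r' * q + z' * z = 1 ->
  head2 p' q' r' z' (head2 p q r z v) = v.
Proof.
move=> h1 h2 h3 h4; apply/rowP=> j; rewrite !mxE /=.
have E (i j' : 'I_N.+2) : i = j' :> nat -> v 0 i = v 0 j'.
  by move/val_inj=> ->.
have [j0|j0] := eqVneq (j : nat) 0%N.
  rewrite (E j 0 j0); transitivity
    ((p' * p + q' * r) * v 0 0 + (p' * q + q' * z) * v 0 1); first by ring.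
  by rewrite h1 h2; ring.
have [j1|//] := eqVneq (j : nat) 1%N.
rewrite (E j 1 j1); transitivity
  ((r' * p + z' * r) * v 0 0 + (r' * q + z' * z) * v 0 1); first by ring.
by rewrite h3 h4; ring.
Qed.

Lemma isometric_head2 a b a' b' s (p q r z : K) :
  p * z - q * r != 0 ->
  (forall x y, a' * (p * x + q * y) ^+ 2 + b' * (r * x + z * y) ^+ 2
     = a * x ^+ 2 + b * y ^+ 2) ->
  isometric (@diag_form K [:: a, b & s]) (@diag_form K [:: a', b' & s]).
Proof.
move=> det0 formP.
pose F := @head2 (size s) p q r z.
pose FL := GRing.isLinear.Build _ _ _ _ F (@head2_linear _ p q r z).
pose F' : {linear 'rV_(size [:: a, b & s]) -> 'rV_(size [:: a', b' & s])} :=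
  HB.pack F FL.
exists F'; split.
  pose D := p * z - q * r.
  exists (@head2 (size s) (z / D) (- q / D) (- r / D) (p / D)) => v;
  by apply: head2_comp; rewrite /D; field.
move=> v; rewrite /= /diag_form /= !big_ord_recl /= !addrA /F !mxE /=.
congr (_ + _).
  rewrite -[v 0 ord0]/(v 0 0) (_ : lift ord0 ord0 = 1); last exact: val_inj.
  exact: formP.
by apply: eq_bigr => i _; rewrite !mxE.
Qed.

(** For a pair, the new orthogonal basis of the plane is x e1 + y e2 and
    - b y e1 + a x e2; the matrix used below is the inverse change of
    coordinates. *)
Lemma chain_isometric s t : s ~~> t ->
  isometric (@diag_form K s) (@diag_form K t).
Proof.
elim=> {s t} [s | s t u _ + _ | a c s t c0 _ | a b s | a b c x y s a0 b0 cE c0].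
- exact: isometric_refl.
- exact: isometric_trans.
- exact: isometric_cons.
- apply: (isometric_head2 s (p := 0) (q := 1) (r := 1) (z := 0)).
    by rewrite mulr0 mulr1 sub0r oppr_eq0 oner_neq0.
  by move=> x y; ring.
- apply: (isometric_head2 s (p := a * x / c) (q := b * y / c)
    (r := - (y / c)) (z := x / c)).
    rewrite (_ : _ - _ = c^-1) ?invr_eq0 // cE; field; by rewrite -cE.
  by move=> x1 y1; rewrite cE; field; rewrite -cE.
Qed.

End Chains.

Notation "s ~~> t" := (chain s t).
#[global] Existing Instance chain_preorder.
#[global] Hint Resolve ChainRefl : core.

(** * Orthogonal bases of one quadratic space are linked by a chain *)

Section OrthogonalBases.
Variables (K : fieldType) (V : lmodType K) (B : V -> V -> K).
Hypothesis two_neq0 : 2%:R != 0 :> K.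
Hypothesis B_sym : forall u v, B u v = B v u.
Hypothesis B_lin : forall k u v w, B (k *: u + v) w = k * B u w + B v w.
Implicit Types (u v e f : V) (es fs : seq V).

Let q v := B v v.

(** Orthogonal systems of anisotropic vectors. *)
Definition orth es :=
  pairwise (fun u v => B u v == 0) es && all (fun v => q v != 0) es.

(** For an orthogonal system es this says that v lies in its span, the
    coefficients being the Fourier coefficients. *)
Definition spanned es v := v = \sum_(e <- es) (B v e / q e) *: e.

Lemma bilZl k u v : B (k *: u) v = k * B u v.
Proof.
have B0 : B 0 v = 0.
  by have := B_lin (-1) 0 0 v; rewrite scaler0 addr0 mulN1r addNr.
by rewrite -[k *: u]addr0 B_lin B0 addr0.
Qed.

Lemma bilDl u v w : B (u + v) w = B u w + B v w.
Proof. by rewrite -[u in LHS]scale1r B_lin mul1r. Qed.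

Lemma bilZr k u v : B u (k *: v) = k * B u v.
Proof. by rewrite B_sym bilZl B_sym. Qed.

Lemma bilDr u v w : B u (v + w) = B u v + B u w.
Proof. by rewrite B_sym bilDl !(B_sym _ u). Qed.

Lemma orth_cons e es :
  orth (e :: es) = [&& q e != 0, all (fun v => B e v == 0) es & orth es].
Proof. by rewrite /orth /= -!andbA; do !bool_congr. Qed.

Lemma orth_perm es fs : perm_eq es fs -> orth es = orth fs.
Proof.
move=> /[dup] /perm_all qE; rewrite /orth qE => efs; congr (_ && _).
apply: (@catCA_perm_ind V (fun s => pairwise _ es = pairwise _ s) _ _ _ efs)
  => //.
move=> s1 s2 s3 ->; rewrite !pairwise_cat !allrel_catr.
have -> : allrel (fun u v => B u v == 0) s1 s2 =
    allrel (fun u v => B u v == 0) s2 s1.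
  by rewrite allrelC; apply: eq_allrel => u v; rewrite B_sym.
by do ![case: (allrel _ _ _) => //=]; do ![case: (pairwise _ _) => //=].
Qed.

Lemma spanned_perm es fs v : perm_eq es fs -> spanned es v -> spanned fs v.
Proof. by move=> efs; rewrite /spanned => {1}->; apply: perm_big. Qed.

(** The coordinates of f on es = ns ++ zs live on ns.  Two vectors of ns whose
    components in f do not add up to an isotropic vector can be replaced by that
    sum and a vector orthogonal to f, so ns loses an element.  If the sums of
    components of e1 and e2, of e1 and e3, and of e2 and e3 were all isotropic,
    then twice the value of the form on the component on e1 would vanish,
    against 2 <> 0.  In the end f itself is proportional to one basis vector, and the
    span has not changed. *)
Lemma bring_to_front N f ns zs : (size ns <= N)%N ->
  orth (ns ++ zs) -> q f != 0 -> all (fun e => B f e == 0) zs ->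
  f = \sum_(e <- ns) (B f e / q e) *: e ->
  exists es, [/\ orth (f :: es), size (ns ++ zs) = size (f :: es),
    map q (ns ++ zs) ~~> map q (f :: es)
    & forall v, spanned (ns ++ zs) v -> spanned (f :: es) v].
Proof.
elim: N f ns zs => [|N IHN] f ns zs nsN onz qf0 fz fE.
  move: nsN fE; rewrite leqn0 => /nilP->; rewrite big_nil => f0.
  by move: qf0; rewrite /q f0 -(scale0r 0) bilZl mul0r eqxx.
(* The claim is invariant under reordering the vectors. *)
have perm_ok ns' zs' : perm_eq (ns ++ zs) (ns' ++ zs') ->
   (exists es, [/\ orth (f :: es), size (ns' ++ zs') = size (f :: es),
    map q (ns' ++ zs') ~~> map q (f :: es)
    & forall v, spanned (ns' ++ zs') v -> spanned (f :: es) v]) ->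
  (exists es, [/\ orth (f :: es), size (ns ++ zs) = size (f :: es),
    map q (ns ++ zs) ~~> map q (f :: es)
    & forall v, spanned (ns ++ zs) v -> spanned (f :: es) v]).
  move=> pe [es [h1 h2 h3 h4]]; exists es; split=> //.
  - by rewrite -h2; apply: perm_size.
  - by apply: ChainTrans h3; apply/chain_perm/perm_map.
  - by move=> v /(spanned_perm pe)/h4.
(* A vector of ns orthogonal to f can be moved to zs. *)
have drop0 e r : perm_eq ns (e :: r) -> B f e = 0 ->
  exists es, [/\ orth (f :: es), size (ns ++ zs) = size (f :: es),
    map q (ns ++ zs) ~~> map q (f :: es)
    & forall v, spanned (ns ++ zs) v -> spanned (f :: es) v].
  move=> nse fe0.
  have pe : perm_eq (ns ++ zs) (r ++ e :: zs).
    by rewrite perm_sym -cat_rcons (permPr (perm_cat nse (perm_refl zs)))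
      perm_cat2r perm_rcons.
  apply: (perm_ok _ _ pe); apply: IHN => //.
  - by rewrite -ltnS; move: nsN; rewrite (perm_size nse).
  - by rewrite -(orth_perm pe).
  - by rewrite /= fe0 eqxx.
  - rewrite {1}fE (perm_big _ nse) big_cons fe0 mul0r scale0r.
    exact: add0r.
(* The replacement of e1, e2 by e1' and e2', where e2' is orthogonal to f. *)
have pair_step e1 e2 r : perm_eq ns [:: e1, e2 & r] ->
    let c := q e1 * (B f e1 / q e1) ^+ 2 + q e2 * (B f e2 / q e2) ^+ 2 in
    c != 0 ->
  exists es, [/\ orth (f :: es), size (ns ++ zs) = size (f :: es),
    map q (ns ++ zs) ~~> map q (f :: es)
    & forall v, spanned (ns ++ zs) v -> spanned (f :: es) v].
  move=> nse; set x := B f e1 / q e1; set y := B f e2 / q e2; move=> c c0.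
  have pe : perm_eq (ns ++ zs) ([:: e1, e2 & r] ++ zs).
    by rewrite perm_cat2r.
  apply: (perm_ok _ _ pe); move: onz; rewrite (orth_perm pe) /= !orth_cons /=.
  case/and4P=> q10 /andP[/eqP B12 B1] q20 /andP[B2 orz].
  pose e1' := x *: e1 + y *: e2.
  pose e2' := (- (q e2 * y)) *: e1 + (q e1 * x) *: e2.
  have Be1' w : B e1' w = x * B e1 w + y * B e2 w by rewrite bilDl !bilZl.
  have Be2' w : B e2' w = - (q e2 * y) * B e1 w + q e1 * x * B e2 w.
    by rewrite bilDl !bilZl.
  have q1' : q e1' = c.
    by rewrite /q Be1' !(B_sym _ e1') !Be1' (B_sym e2) B12 -!/(q _) /c; ring.
  have q2' : q e2' = q e1 * q e2 * c.
    by rewrite /q Be2' !(B_sym _ e2') !Be2' (B_sym e2) B12 -!/(q _) /c; ring.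
  have B12' : B e1' e2' = 0.
    by rewrite Be1' !(B_sym _ e2') !Be2' (B_sym e2) B12 -!/(q _); ring.
  have fe1 : B f e1 = q e1 * x by rewrite /x mulrC divfK.
  have fe2 : B f e2 = q e2 * y by rewrite /y mulrC divfK.
  have pe' : perm_eq ((e1' :: r) ++ e2' :: zs) [:: e1', e2' & r ++ zs].
    by rewrite /= perm_cons -cat_rcons -[e2' :: _ ++ _]/((e2' :: r) ++ zs)
      perm_cat2r perm_rcons.
  have [|||||es [h1 h2 h3 h4]] := IHN f (e1' :: r) (e2' :: zs).
  - by rewrite -ltnS; move: nsN; rewrite (perm_size nse).
  - rewrite (orth_perm pe') !orth_cons q1' q2' c0 !mulf_neq0 //= B12' eqxx orz.
    rewrite andbT /=.
    apply/andP; split; apply/allP=> w w_in; rewrite ?Be1' ?Be2';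
    by move/allP: B1 => /(_ _ w_in)/eqP->; move/allP: B2 => /(_ _ w_in)/eqP->;
      rewrite !mulr0 addr0.
  - by [].
  - rewrite /= fz andbT; apply/eqP.
    by rewrite B_sym Be2' !(B_sym _ f) fe1 fe2; ring.
  - have -> : \sum_(e <- e1' :: r) (B f e / q e) *: e =
        \sum_(e <- [:: e1, e2 & r]) (B f e / q e) *: e.
      rewrite !big_cons addrA; congr (_ + _).
      have -> : B f e1' = c.
        by rewrite B_sym Be1' !(B_sym _ f) fe1 fe2 /c; ring.
      by rewrite q1' divff // scale1r.
    by rewrite {1}fE (perm_big _ nse).
  exists es; split=> //.
  - by rewrite -[RHS]h2 /= !size_cat /= addnS.
  - apply: ChainTrans h3; rewrite /= !map_cat /=.
    apply: ChainTrans
      (_ : [:: q e1', q e2' & map q r ++ map q zs] ~~> _); last first.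
      apply/chain_perm; rewrite perm_cons -cat_rcons.
      by rewrite -[q e2' :: _ ++ _]/((q e2' :: map q r) ++ _)
        perm_cat2r perm_sym perm_rcons.
    by rewrite q1' q2'; apply: ChainPair c0.
  - move=> v vE; apply: h4; rewrite /spanned {1}vE.
    rewrite [RHS](perm_big _ pe').
    rewrite !big_cons /= !addrA; congr (_ + _).
    rewrite q1' q2' !(B_sym v) Be1' Be2' /e1' /e2' !scalerDr !scalerA.
    rewrite addrACA -!scalerDl; congr (_ *: _ + _ *: _); rewrite /c; field;
    by rewrite q10 q20 -/c c0.
case: ns => [|e1 ns] in nsN onz fE perm_ok drop0 pair_step *.
  by apply: IHN => //.
have [f1|f1] := eqVneq (B f e1) 0; first exact: drop0 f1.
case: ns => [|e2 ns] in nsN onz fE perm_ok drop0 pair_step *.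
  have q10 : q e1 != 0 by move: onz; rewrite orth_cons; case/and3P.
  move: fE; rewrite big_seq1; set x := B f e1 / q e1 => fE.
  have x0 : x != 0 by rewrite mulf_neq0 ?invr_eq0.
  have qfE : q f = q e1 * x ^+ 2.
    by rewrite /q fE bilZl bilZr mulrA -expr2 mulrC.
  have e1E : e1 = x^-1 *: f by rewrite {1}fE scalerA mulVf ?scale1r.
  exists zs; split=> //.
  - by rewrite orth_cons qf0 fz; move: onz; rewrite orth_cons; case/and3P.
  - rewrite /= -[q e1](@mulfK _ (x ^+ 2)) ?expf_neq0 // -qfE -exprVn.
    by apply: chain_sq; rewrite invr_eq0.
  - move=> v; rewrite /spanned /= !big_cons => {1}->; congr (_ + _).
    rewrite {1 3}e1E bilZr scalerA; congr (_ *: _).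
    by rewrite qfE; field; rewrite q10 x0.
case: ns => [|e3 ns] in nsN onz fE perm_ok drop0 pair_step *.
  apply: pair_step (perm_refl _) _; apply: contraNneq qf0 => c0.
  move: onz; rewrite !orth_cons /= => /and3P[_ /andP[/eqP B12 _] _].
  move: fE; rewrite !big_cons big_nil addr0 => fE; apply/eqP.
  rewrite -[RHS]c0 {1}/q {1}fE.
  move: (B f e1 / q e1) (B f e2 / q e2) fE => x y fE.
  rewrite fE bilDl !bilZl !bilDr !bilZr (B_sym e2) B12 /q; ring.
have := pair_step _ _ _ (perm_refl _) => /=.
have p3 : perm_eq [:: e1, e2, e3 & ns] [:: e1, e3, e2 & ns].
  by rewrite perm_cons -[e2 :: _]/([:: e2] ++ [:: e3] ++ ns) perm_catCA.
have := pair_step _ _ _ p3 => /=.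
have p4 : perm_eq [:: e1, e2, e3 & ns] [:: e2, e3, e1 & ns].
  by rewrite -[e1 :: _]/([:: e1] ++ [:: e2; e3] ++ ns) perm_catCA.
have := pair_step _ _ _ p4 => /=.
have : q e1 * (B f e1 / q e1) ^+ 2 != 0.
  have q10 : q e1 != 0 by move: onz; rewrite orth_cons; case/and3P.
  by rewrite mulf_neq0 // expf_neq0 // mulf_neq0 ?invr_eq0.
move: (q e1 * _) (q e2 * _) (q e3 * _) => x y z x0.
have [yz0 | yz0 h _ _] := eqVneq (y + z) 0; last exact: h.
have [xz0 | xz0 _ h _] := eqVneq (x + z) 0; last exact: h.
have [xy0 | xy0 _ _ h] := eqVneq (x + y) 0; last exact: h.
suff : 2%:R * x = 0 by move/eqP; rewrite mulf_eq0 (negPf two_neq0) (negPf x0).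
have -> : 2%:R * x = (x + y) + (x + z) - (y + z) by ring.
by rewrite xy0 xz0 yz0 addr0 subr0.
Qed.

(** Chain equivalence: bring the first vector f of fs to the front of es; the
    remaining vectors of the two systems are orthogonal bases of the same
    complement of f. *)
Lemma chain_of_orth es fs : size es = size fs -> orth es -> orth fs ->
  (forall f, f \in fs -> spanned es f) -> map q es ~~> map q fs.
Proof.
elim: fs es => [|f fs IH] es /= sz oes ofs sp.
  by rewrite (size0nil sz); apply: ChainRefl.
move: ofs; rewrite orth_cons => /and3P[qf0 ffs ofs].
have [|||es' [oes' sz' ch sp']] :=
    @bring_to_front (size es) f es [::] (leqnn _) _ qf0.
- by rewrite cats0.
- by [].
- by apply: sp; rewrite mem_head.
rewrite cats0 in sz' ch sp'; apply: ChainTrans ch _.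
move: (oes'); rewrite orth_cons => /and3P[_ _ oes''].
apply: chain_cons; apply: IH => //; first by move: sz'; rewrite sz => -[].
move=> g g_in; have := sp' g (sp g _); rewrite inE g_in orbT => /(_ isT).
by rewrite /spanned big_cons B_sym (eqP (allP ffs g g_in)) mul0r scale0r add0r.
Qed.

End OrthogonalBases.

Section Diagonalization.
Variable K : fieldType.
Hypothesis two_neq0 : 2%:R != 0 :> K.

Definition diag_bil (s : seq K) (u v : 'rV[K]_(size s)) : K :=
  \sum_(i < size s) s`_i * (u 0 i * v 0 i).

Lemma isometric_dim (V : vectType K) (p : V -> K) (s : seq K) :
  isometric p (@diag_form K s) -> size s = \dim {:V}.
Proof.
case=> f [[g fK gK] _]; have := limg_dim_eq (f := linfun f) (U := fullv).
have -> : lker (linfun f) = 0%VS.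
  by apply/eqP/lker0P => u v; rewrite !lfunE /= => /(can_inj fK).
rewrite capv0 => /(_ erefl) <-.
have -> : (linfun f @: fullv)%VS = fullv.
  apply/eqP; rewrite eqEsubv subvf /=; apply/subvP => v _.
  by rewrite -[v]gK -(lfunE f) memv_img ?memvf.
by rewrite dimvf /dim /= mul1n.
Qed.

Lemma isometric_polar (V : vectType K) (B : V -> V -> K) (s : seq K)
    (f : {linear V -> 'rV[K]_(size s)}) :
  (forall u v, B u v = B v u) ->
  (forall k u v w, B (k *: u + v) w = k * B u w + B v w) ->
  (forall v, diag_form (f v) = B v v) ->
  forall u v, diag_bil (f u) (f v) = B u v.
Proof.
move=> B_sym B_lin fP u v; apply: (mulfI two_neq0).
have -> : 2%:R * diag_bil (f u) (f v) =
    diag_form (f (u + v)) - diag_form (f u) - diag_form (f v).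
  rewrite /diag_bil /diag_form -!sumrB mulr_sumr; apply: eq_bigr => i _.
  by rewrite raddfD mxE; ring.
rewrite !fP (bilDl B_lin) !(bilDr B_sym B_lin) (B_sym v u); ring.
Qed.

(** Every diagonalization of a form is linked by a chain to the diagonalization
    given by any orthogonal basis: transport the basis to the coordinate space
    and compare it with the standard basis. *)
Lemma chain_of_orth_basis (V : vectType K) (B : V -> V -> K) (s : seq K)
    (fs : seq V) :
  (forall u v, B u v = B v u) ->
  (forall k u v w, B (k *: u + v) w = k * B u w + B v w) ->
  isometric (fun v => B v v) (@diag_form K s) ->
  all (fun c => c != 0) s -> orth B fs -> size fs = size s ->
  s ~~> [seq B v v | v <- fs].
Proof.
move=> B_sym B_lin [f [_ fP]] s0 ofs sz.
have fB := isometric_polar B_sym B_lin fP.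
pose D := @diag_bil s.
have D_sym u v : D u v = D v u.
  by apply: eq_bigr => i _; rewrite [u 0 i * _]mulrC.
have D_lin k u v w : D (k *: u + v) w = k * D u w + D v w.
  rewrite /D /diag_bil mulr_sumr -big_split; apply: eq_bigr => i _ /=.
  by rewrite !mxE; ring.
have D_delta v i : D v (delta_mx 0 i) = s`_i * v 0 i.
  rewrite /D /diag_bil (bigD1 i) //= big1 => [|j ji]; rewrite !mxE ?eqxx.
    by rewrite addr0 mulr1.
  by rewrite (negPf ji) !mulr0.
pose es := [seq delta_mx 0 i : 'rV[K]_(size s) | i <- enum 'I_(size s)].
have q_delta i : D (delta_mx 0 i) (delta_mx 0 i) = s`_i.
  by rewrite D_delta mxE !eqxx mulr1.
have s_nz (i : 'I_(size s)) : s`_i != 0 by apply: (allP s0); apply: mem_nth.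
have -> : s = [seq D e e | e <- es].
  rewrite -map_comp (eq_map q_delta) -[LHS](mkseq_nth 0) /mkseq.
  by rewrite -val_enum_ord -map_comp.
have -> : [seq B v v | v <- fs] = [seq D e e | e <- map f fs].
  by rewrite -map_comp; apply: eq_map => v /=; rewrite -fB.
apply: (@chain_of_orth _ _ _ two_neq0 D_sym D_lin).
- by rewrite [LHS]size_map [RHS]size_map size_enum_ord sz.
- rewrite /orth; apply/andP; split; last first.
    by rewrite all_map; apply/allP => i _ /=; rewrite q_delta.
  rewrite pairwise_map; have := enum_uniq 'I_(size s); rewrite uniq_pairwise.
  by apply: sub_pairwise => i j /= ij; rewrite D_delta mxE eqxx [j == i]eq_sym
    (negPf ij) mulr0.
- move: ofs; rewrite /orth all_map pairwise_map => /andP[h1 h2].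
  apply/andP; split; last by apply: sub_all h2 => v /=; rewrite -fB.
  by apply: sub_pairwise h1 => u v /=; rewrite -fB.
- move=> v _; rewrite /spanned big_map big_enum /=; apply/rowP=> j.
  rewrite summxE (bigD1 j) //= big1 => [|i ij].
    by rewrite D_delta q_delta !mxE !eqxx mulr1 addr0 mulrC mulKf.
  by rewrite !mxE [j == i]eq_sym (negPf ij) mulr0.
Qed.

End Diagonalization.

(** * The symmetric power as a recursion *)

Section ExponentVectors.
Local Open Scope nat_scope.

Definition incr_head (l : seq nat) : seq nat := (head 0 l).+1 :: behead l.

(** The exponent vectors of the degree k monomials in N variables, sorted by
    whether the first variable divides the monomial. *)
Fixpoint expvec N : nat -> seq (seq nat) :=
  if N is N'.+1 then
    fix f k := if k is k'.+1
      then map incr_head (f k') ++ map (cons 0) (expvec N' k)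
      else map (cons 0) (expvec N' 0)
  else fun k => if k is 0 then [:: [::]] else [::].

Lemma expvecS N k : expvec N.+1 k.+1 =
  map incr_head (expvec N.+1 k) ++ map (cons 0) (expvec N k.+1).
Proof. by []. Qed.

Lemma mem_expvec N k l :
  (l \in expvec N k) = (size l == N) && (sumn l == k).
Proof.
elim: N k l => [|N IHN] k l; first by case: k l => [|k] [|x l].
have cons0 k' l' : (l' \in map (cons 0) (expvec N k')) =
    [&& size l' == N.+1, sumn l' == k' & head 0 l' == 0].
  apply/mapP/and3P => [[l'' + ->]|].
    by rewrite IHN => /andP[/eqP<- /eqP<-].
  case: l' => [[]//|x l'] [/= sz sm /eqP x0]; exists l'; rewrite ?x0 //.
  by rewrite IHN -(eqP sm) x0 -eqSS sz eqxx.
elim: k l => [|k IHk] l.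
  by rewrite [expvec _ _]/= cons0; case: l => [|[|x] l] //=; rewrite andbT.
rewrite expvecS mem_cat cons0; case: l => [|[|x] l].
- by rewrite orbF; apply/negP => /mapP[l' _].
- by rewrite andbT orb_idl // => /mapP[l' _].
rewrite !andbF orbF /= addSn eqSS; apply/mapP/andP => [[l']|[sz sm]].
  by rewrite IHk; case: l' => [|y l'] //= /andP[/eqP[<-] /eqP<-] [-> ->].
by exists (x :: l) => //; rewrite IHk; apply/andP.
Qed.

Lemma expvec_uniq N k : uniq (expvec N k).
Proof.
elim: N k => [|N IHN] k; first by case: k.
have inj0 : injective (cons 0) by move=> l l' [].
elim: k => [|k IHk]; first by rewrite /= map_inj_uniq.
rewrite expvecS cat_uniq (map_inj_uniq inj0) IHN andbT.
rewrite map_inj_in_uniq ?IHk ?andbT; last first.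
  move=> [|x l] [|y l']; rewrite !mem_expvec // => _ _ [].
  by move=> -> ->.
by apply/hasPn => l /mapP[l' _ ->]; apply/mapP => -[].
Qed.

End ExponentVectors.

(** The recursion h_k(a, s) = a h_(k-1)(a, s) + h_k(s) of the complete
    symmetric functions. *)
Fixpoint sympow_rec (K : fieldType) (s : seq K) : nat -> seq K :=
  if s is a :: s' then
    fix f k := if k is k'.+1 then dscale a (f k') ++ sympow_rec s' k
               else sympow_rec s' 0
  else fun k => if k is 0 then [:: 1] else [::].

HB.lock Definition sympow (K : fieldType) (s : seq K) (k : nat) : seq K :=
  sympow_rec s k.

Section SymmetricPower.
Variable K : fieldType.
Implicit Types (s t u : seq K) (a b c : K).

Lemma sympow0 s : sympow s 0 = [:: 1].
Proof. by rewrite unlock; elim: s. Qed.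

Lemma sympow_nil k : sympow [::] k = if k is 0 then [:: 1] else [::] :> seq K.
Proof. by rewrite unlock. Qed.

Lemma sympowS a s k :
  sympow (a :: s) k.+1 = dscale a (sympow (a :: s) k) ++ sympow s k.+1.
Proof. by rewrite unlock. Qed.

Lemma sympow_expvec s k : sympow s k =
  [seq \prod_(i < size s) s`_i ^+ nth 0%N l i | l <- expvec (size s) k].
Proof.
elim: s k => [|a s IHs] k.
  by case: k => [|k]; rewrite sympow_nil //= big_ord0.
elim: k => [|k IHk].
  rewrite sympow0 -(sympow0 s) IHs /= -map_comp; apply: eq_map => l /=.
  by rewrite big_ord_recl /= expr0 mul1r.
rewrite sympowS IHk IHs [size (a :: s)]/= expvecS map_cat.
rewrite /dscale -!map_comp; congr (_ ++ _); apply: eq_map => l /=.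
  rewrite !big_ord_recl /= exprS mulrA; case: l => /= [|x l].
    by congr (_ * _); apply: eq_bigr => i _; rewrite !nth_nil.
  by [].
by rewrite big_ord_recl /= expr0 mul1r.
Qed.

Lemma dsym_power_sympow k s : perm_eq (dsym_power k s) (sympow s k).
Proof.
rewrite sympow_expvec /dsym_power.
set A := [set t : (size s).-tuple 'I_k.+1 | (\sum_(i <- t) i == k)%N].
have -> : [seq \prod_(i < size s) s`_i ^+ tnth t i
             | t : (size s).-tuple 'I_k.+1 in A] =
    [seq \prod_(i < size s) s`_i ^+ nth 0%N l i | l <-
      [seq map val (val t) | t : (size s).-tuple 'I_k.+1 in A]].
  rewrite -[RHS]map_comp; apply: eq_map => t /=; apply: eq_bigr => i _.
  by rewrite (nth_map ord0) ?size_tuple // (tnth_nth ord0).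
apply/perm_map/uniq_perm; rewrite ?expvec_uniq //.
  rewrite map_inj_uniq ?enum_uniq // => t t' /inj_map e.
  by apply/val_inj/e/val_inj.
move=> l; rewrite mem_expvec; apply/mapP/andP => [[t tA ->]|[/eqP sz /eqP sm]].
  rewrite size_map size_tuple eqxx; split=> //.
  by move: tA; rewrite mem_enum inE sumnE big_map.
have lk : all (fun x => x < k.+1)%N l.
  apply/allP => x xl; rewrite ltnS -sm.
  by rewrite sumnE (perm_big _ (perm_to_rem xl)) big_cons leq_addr.
have tsz : size [seq inord x : 'I_k.+1 | x <- l] == size s.
  by rewrite size_map sz.
have tE : map val (Tuple tsz) = l.
  rewrite /= -map_comp -[RHS]map_id; apply/eq_in_map => x /(allP lk) xk /=.
  by rewrite inordK.
exists (Tuple tsz) => //; rewrite mem_enum inE.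
by rewrite -[X in _ == X]sm -[in X in _ == X]tE sumnE big_map.
Qed.

End SymmetricPower.

(** * Symmetric powers respect chains *)

(** Reorderings of concatenations, by counting. *)
Ltac perm_cat_tac :=
  apply/permP => ?; rewrite ?count_cat; ring.

Section ChainSym.
Variable K : fieldType.
Implicit Types (s t u X : seq K) (a b c : K).


Lemma dscale_cat c s t : dscale c (s ++ t) = dscale c s ++ dscale c t.
Proof. exact: map_cat. Qed.

Lemma dscaleA b c s : dscale b (dscale c s) = dscale (b * c) s.
Proof. by rewrite /dscale -map_comp; apply: eq_map => x /=; rewrite mulrA. Qed.

Lemma dscale1 s : dscale 1 s = s.
Proof. by rewrite -[RHS]map_id; apply: eq_map => x; rewrite mul1r. Qed.

Lemma chain_dscale c s t : s ~~> t -> dscale c s ~~> dscale c t.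
Proof.
have [-> st|c0] := eqVneq c 0.
  have E u : dscale 0 u = nseq (size u) 0.
    by elim: u => //= x u ->; rewrite mul0r.
  by rewrite !E (chain_size st).
elim=> {s t} //= [s t u _ + _ | a d s t d0 _ IH | a b s
  | a b d x y s a0 b0 dE d0].
- exact: ChainTrans.
- by rewrite mulrA; apply: ChainCons.
- exact: ChainSwap.
- apply: ChainTrans (ChainPair (c := c * d) (x := x) (y := y) _ _ _ _ _) _.
  + by rewrite mulf_neq0.
  + by rewrite mulf_neq0.
  + by rewrite dE; ring.
  + by rewrite mulf_neq0.
  have -> : c * a * (c * b) * (c * d) = c * (a * b * d) * c ^+ 2 by ring.
  exact/chain_cons/chain_sq.
Qed.

Lemma chain_dscale_sq a c s : c != 0 -> dscale (a * c ^+ 2) s ~~> dscale a s.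
Proof.
move=> c0; elim: s => [|x s IHs] /=; first by [].
by rewrite mulrAC; apply: ChainCons.
Qed.

Lemma chain_dscale_sqV a c s : c != 0 -> dscale a s ~~> dscale (a * c ^+ 2) s.
Proof.
move=> c0; rewrite -{1}[a](mulfK (expf_neq0 2 c0)) -exprVn.
by apply: chain_dscale_sq; rewrite invr_eq0.
Qed.

Lemma sympow_cons_chain a c s t : c != 0 ->
  (forall k, sympow s k ~~> sympow t k) ->
  forall k, sympow (a * c ^+ 2 :: s) k ~~> sympow (a :: t) k.
Proof.
move=> c0 st; elim=> [|k IHk]; first by rewrite !sympow0.
rewrite !sympowS; apply: chain_cat; last exact: st.
transitivity (dscale a (sympow (a * c ^+ 2 :: s) k)).
  exact: chain_dscale_sq.
exact: chain_dscale.
Qed.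

(** By induction on the degree: with S = S(a, b, s), both sides become
    a b S_k + a S_(k+1)(a, s) + b S_(k+1)(b, s) + S_(k+2)(s) in degree k + 2. *)
Lemma sympow_swap a b s k :
  perm_eq (sympow [:: a, b & s] k) (sympow [:: b, a & s] k).
Proof.
elim/ltn_ind: k => -[|[|k]] IH; first by rewrite !sympow0.
  by rewrite !sympowS !sympow0; perm_cat_tac.
have IH1 := IH k.+1 (leqnn _).
have /permP Ea := perm_map ( *%R a) IH1.
have /permP Eb := perm_map ( *%R b) IH1.
have /permP E := perm_map ( *%R (a * b)) (IH k (leqnSn _)).
apply/permP => P; rewrite -!/(dscale _ _) in Ea Eb E.
rewrite ![sympow [:: _, _ & s] k.+2]sympowS !count_cat Ea -Eb.
rewrite !sympowS !dscale_cat !dscaleA !count_cat.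
by rewrite [b * a]mulrC E; ring.
Qed.

Section Pair.
Variables (a b c d : K) (u : seq K).
Hypotheses (b0 : b != 0) (c0 : c != 0) (d0 : d != 0).
Hypothesis a0 : a != 0.
Hypothesis pair : [:: a; b] ~~> [:: c; d].
Hypothesis det : c * d = a * b * c ^+ 2.

Let pair_dscale X : dscale a X ++ dscale b X ~~> dscale c X ++ dscale d X.
Proof.
elim: X => [|x X IHX] /=; first by [].
transitivity ([:: a * x; b * x] ++ (dscale a X ++ dscale b X)).
  by apply: chain_perm; rewrite /= perm_cons -cat1s perm_catCA.
transitivity ([:: c * x; d * x] ++ (dscale c X ++ dscale d X)).
  apply: chain_cat IHX; rewrite ![_ * x]mulrC.
  exact: (chain_dscale x pair).
by apply: chain_perm; rewrite /= perm_cons -[_ :: _ ++ _]cat1s perm_catCA.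
Qed.

Let pair_det X : X ++ dscale (a * b) X ~~> X ++ dscale (c * d) X.
Proof. by apply: chain_cat => //; rewrite det; apply: chain_dscale_sqV. Qed.

Let f k := sympow (b :: u) k.
Let g k := sympow (d :: u) k.

(** Modulo squares (a + b) b = a b + 1 and (1 + a b) b = a + b, so the form
    a S(b, u) + b S(b, u) and its companion S(b, u) + a b S(b, u) determine each
    other through the recursion for S(b, u). *)
Let pair_step k :
  dscale a (f k) ++ dscale b (f k) ~~> dscale c (g k) ++ dscale d (g k) /\
  f k ++ dscale (a * b) (f k) ~~> g k ++ dscale (c * d) (g k).
Proof.
elim: k => [|k [IHP IHQ]]; first by rewrite /f /g !sympow0.
rewrite /f /g !sympowS -/(f k) -/(g k); move: (sympow u k.+1) => U.
rewrite !dscale_cat !dscaleA; split.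
  transitivity ((f k ++ dscale (a * b) (f k)) ++ (dscale a U ++ dscale b U)).
    transitivity ((dscale (1 * b ^+ 2) (f k) ++ dscale (a * b) (f k)) ++
      (dscale a U ++ dscale b U)).
      by apply/chain_perm; rewrite mul1r expr2; perm_cat_tac.
    do 2!apply: chain_cat => //.
    by rewrite -{2}[f k]dscale1; apply: chain_dscale_sq.
  transitivity ((g k ++ dscale (c * d) (g k)) ++ (dscale c U ++ dscale d U)).
    exact: chain_cat.
  transitivity ((dscale (1 * d ^+ 2) (g k) ++ dscale (c * d) (g k)) ++
      (dscale c U ++ dscale d U)).
    do 2!apply: chain_cat => //.
    by rewrite -{1}[g k]dscale1; apply: chain_dscale_sqV.
  by apply/chain_perm; rewrite mul1r expr2; perm_cat_tac.
transitivity ((dscale a (f k) ++ dscale b (f k)) ++ (U ++ dscale (a * b) U)).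
  transitivity ((dscale (a * b ^+ 2) (f k) ++ dscale b (f k)) ++
      (U ++ dscale (a * b) U)).
    by apply/chain_perm; rewrite expr2 mulrA; perm_cat_tac.
  by do 2!apply: chain_cat => //; apply: chain_dscale_sq.
transitivity ((dscale c (g k) ++ dscale d (g k)) ++ (U ++ dscale (c * d) U)).
  exact: chain_cat.
transitivity ((dscale (c * d ^+ 2) (g k) ++ dscale d (g k)) ++
    (U ++ dscale (c * d) U)).
  by do 2!apply: chain_cat => //; apply: chain_dscale_sqV.
by apply/chain_perm; rewrite expr2 mulrA; perm_cat_tac.
Qed.

(** Unfolding twice, S_(k+2)(a, b, u) is a^2 S_k(a, b, u) +
    (a + b) S_(k+1)(b, u) + S_(k+2)(u). *)
Lemma sympow_pair_chain k : sympow [:: a, b & u] k ~~> sympow [:: c, d & u] k.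
Proof.
elim/ltn_ind: k => -[|[|k]] IH; first by rewrite !sympow0.
  rewrite !sympowS !sympow0 !catA.
  by apply: chain_cat => //; apply: pair_dscale.
have E x y : sympow [:: x, y & u] k.+2 =
    dscale (x ^+ 2) (sympow [:: x, y & u] k) ++
    (dscale x (sympow (y :: u) k.+1) ++ dscale y (sympow (y :: u) k.+1)) ++
    sympow u k.+2.
  by rewrite !sympowS !dscale_cat !dscaleA -expr2 -!catA.
rewrite !E; apply: chain_cat; last first.
  by apply: chain_cat => //; case: (pair_step k.+1).
rewrite -[a ^+ 2]mul1r -[c ^+ 2]mul1r.
transitivity (dscale 1 (sympow [:: a, b & u] k)); first exact: chain_dscale_sq.
transitivity (dscale 1 (sympow [:: c, d & u] k)); last exact: chain_dscale_sqV.
by rewrite !dscale1; apply: IH.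
Qed.

End Pair.

(** The symmetric power of a form depends on its isometry class only, because
    it respects the elementary moves. *)
Lemma sympow_chain s t k : s ~~> t -> sympow s k ~~> sympow t k.
Proof.
move=> st; elim: st k => {s t} [s | s t u _ IH1 _ IH2 | a c s t c0 _ IH
  | a b s | a b c x y s a0 b0 cE c0] k.
- by [].
- exact: ChainTrans (IH1 k) (IH2 k).
- exact: sympow_cons_chain.
- exact/chain_perm/sympow_swap.
- apply: sympow_pair_chain => //; first by rewrite !mulf_neq0.
    exact: ChainPair cE c0.
  by ring.
Qed.

End ChainSym.

(** * Reduction modulo hyperbolic planes *)

Reserved Notation "s ~h> t" (at level 70, no associativity).

Section Hyperbolic.
Variable K : fieldType.
Hypothesis two_neq0 : 2%:R != 0 :> K.
Implicit Types (s t u X Y : seq K) (a b c : K) (f g : nat -> seq K).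
Let H := hyperbolic_plane K.

(** Equality in the Witt ring in a directed form: hyperbolic planes may be split
    off on the right only, so a relation s ~h> t is still an isometry of s with
    the sum of t and some number of planes. *)
Definition hchain s t := exists h, s ~~> t ++ dcopies h (hyperbolic_plane K).
Local Notation "s ~h> t" := (hchain s t).

Lemma dcopiesD r r' s : dcopies (r + r') s = dcopies r s ++ dcopies r' s.
Proof. by rewrite /dcopies nseqD flatten_cat. Qed.

Lemma dscale_dcopies c r s : dscale c (dcopies r s) = dcopies r (dscale c s).
Proof. by rewrite /dcopies; elim: r => //= r IHr; rewrite dscale_cat IHr. Qed.

Lemma size_dcopies r s : size (dcopies r s) = (r * size s)%N.
Proof. by elim: r => //= r IHr; rewrite size_cat -/(dcopies r s) IHr mulSn. Qed.

Lemma chain_hchain s t : s ~~> t -> s ~h> t.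
Proof. by exists 0%N; rewrite cats0. Qed.

Lemma hchain_refl s : s ~h> s.
Proof. exact: chain_hchain. Qed.
#[local] Hint Resolve hchain_refl : core.

Lemma hchain_trans t s u : s ~h> t -> t ~h> u -> s ~h> u.
Proof.
move=> [h st] [h' tu]; exists (h' + h)%N; rewrite dcopiesD catA.
exact/(ChainTrans st)/chain_cat.
Qed.

Lemma hchain_cat s s' t t' : s ~h> s' -> t ~h> t' -> s ++ t ~h> s' ++ t'.
Proof.
move=> [h ss'] [h' tt']; exists (h + h')%N.
apply: ChainTrans (chain_cat ss' tt') (chain_perm _).
by rewrite dcopiesD; perm_cat_tac.
Qed.

Lemma chain_hyperbolic c : c != 0 -> dscale c H ~~> H.
Proof.
move=> c0; rewrite /H /hyperbolic_plane /= mulr1 mulrN1.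
apply: ChainTrans (ChainPair (c := 1) (x := (1 + c^-1) / 2%:R)
  (y := (1 - c^-1) / 2%:R) [::] c0 _ _ (oner_neq0 _)) _.
- by rewrite oppr_eq0.
- by field; rewrite c0 two_neq0.
apply: chain_cons; rewrite mulr1 mulrN -expr2 -mulN1r.
exact: chain_sq.
Qed.

Lemma hchain_dscale c s t : c != 0 -> s ~h> t -> dscale c s ~h> dscale c t.
Proof.
move=> c0 [h st]; exists h; apply: ChainTrans (chain_dscale c st) _.
rewrite dscale_cat; apply: chain_cat => //.
elim: h {st} => [|h IHh]; first exact: ChainRefl.
rewrite -[dcopies h.+1 _]/(H ++ dcopies h H) dscale_cat.
exact: chain_cat (chain_hyperbolic c0) IHh.
Qed.

Lemma hchain_opp s : all (fun c => c != 0) s -> s ++ dscale (-1) s ~h> [::].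
Proof.
elim: s => [|x s IHs] //= /andP[x0 /IHs sH].
apply: (@hchain_trans ([:: x; - 1 * x] ++ (s ++ dscale (-1) s))).
  apply/chain_hchain/chain_perm.
  by rewrite /= perm_cons; apply/permPl/(perm_catCA s [:: _]).
apply: (@hchain_trans ([::] ++ [::])) => //; apply: hchain_cat sH.
exists 1%N; apply: ChainTrans (chain_hyperbolic x0).
by rewrite /= mulr1 mulrC.
Qed.

(** A sequence f of forms stands for the power series with coefficients f k;
    [mul_lin a] is multiplication by 1 + a t. *)
Definition mul_lin a f k :=
  if k is k'.+1 then f k ++ dscale a (f k') else f 0%N.

(** Division by 1 - t^2. *)
Fixpoint div_sq f k := if k is k'.+2 then f k ++ div_sq f k' else f k.

Lemma nat_ind2 (P : nat -> Prop) :
  P 0%N -> P 1%N -> (forall k, P k -> P k.+1 -> P k.+2) -> forall k, P k.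
Proof.
move=> P0 P1 PS k; suff [] : P k /\ P k.+1 by [].
by elim: k => // k [] *; split=> //; apply: PS.
Qed.

Lemma div_sqE f g : g 0%N ~h> f 0%N -> g 1%N ~h> f 1%N ->
  (forall k, g k.+2 ~h> f k.+2 ++ g k) -> forall k, g k ~h> div_sq f k.
Proof.
move=> h0 h1 hS; elim/nat_ind2 => // k IHk _.
by apply: hchain_trans (hS k) _; apply: hchain_cat.
Qed.

Lemma eq_div_sq f g : (forall k, f k ~h> g k) ->
  forall k, div_sq f k ~h> div_sq g k.
Proof. by move=> fg; elim/nat_ind2 => //= k IHk _; apply: hchain_cat. Qed.

Lemma eq_iter_div_sq f g M : (forall k, f k ~h> g k) ->
  forall k, iter M div_sq f k ~h> iter M div_sq g k.
Proof. by move=> fg; elim: M => //= M; apply: eq_div_sq. Qed.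

Lemma eq_mul_lin a f g : a != 0 -> (forall k, f k ~h> g k) ->
  forall k, mul_lin a f k ~h> mul_lin a g k.
Proof.
move=> a0 fg [|k] /=; first exact: fg.
by apply: hchain_cat => //; apply: hchain_dscale.
Qed.

Lemma mul_lin_div_sq a f k : mul_lin a (div_sq f) k ~h> div_sq (mul_lin a f) k.
Proof.
apply: div_sqE => // -[|i]; apply/chain_hchain/chain_perm.
  by rewrite /=; perm_cat_tac.
by rewrite /= !dscale_cat; perm_cat_tac.
Qed.

Lemma mul_lin_iter_div_sq a f M k :
  mul_lin a (iter M div_sq f) k ~h> iter M div_sq (mul_lin a f) k.
Proof.
elim: M k => //= M IHM k; apply: hchain_trans (mul_lin_div_sq _ _ _) _.
exact: eq_div_sq.
Qed.

(** The coefficients of the product of the 1 + a t over the entries a, i.e. the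
    exterior powers. *)
Definition extpow s : nat -> seq K :=
  foldr mul_lin (fun k => if k is 0 then [:: 1] else [::]) s.

(** Modulo squares 1 / (1 - a t) = (1 + a t) / (1 - t^2). *)
Lemma sympow_cons_div_sq a s k : a != 0 ->
  sympow (a :: s) k ~h> div_sq (mul_lin a (sympow s)) k.
Proof.
move=> a0; apply: div_sqE => {k} [||k] /=; apply: chain_hchain.
- by rewrite !sympow0.
- by rewrite sympowS !sympow0; apply: chain_perm; perm_cat_tac.
rewrite 2!sympowS dscale_cat dscaleA.
transitivity (dscale 1 (sympow (a :: s) k) ++ dscale a (sympow s k.+1) ++
  sympow s k.+2).
  rewrite -catA; apply: chain_cat => //; rewrite -expr2 -[a ^+ 2]mul1r.
  exact: chain_dscale_sq.
by rewrite dscale1; apply: chain_perm; perm_cat_tac.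
Qed.

Lemma sympow_extpow s k : all (fun c => c != 0) s ->
  sympow s k ~h> iter (size s) div_sq (extpow s) k.
Proof.
elim: s k => [|a s IHs] k /=; first by case: k => [|k]; rewrite sympow_nil.
case/andP=> a0 s0; apply: hchain_trans (sympow_cons_div_sq _ _ a0) _.
apply: eq_div_sq => {}k; apply: hchain_trans (mul_lin_iter_div_sq _ _ _ _).
by apply: eq_mul_lin => // {}k; apply: IHs.
Qed.

Lemma sympow_nz s k : all (fun c => c != 0) s ->
  all (fun c => c != 0) (sympow s k).
Proof.
elim: s k => [|a s IHs] k /=.
  by case: k => [|k] _; rewrite sympow_nil //= oner_neq0.
case/andP=> a0 s0; elim: k => [|k IHk]; first by rewrite sympow0 /= oner_neq0.
rewrite sympowS all_cat IHs // andbT all_map; apply: sub_all IHk => x /=.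
exact: mulf_neq0.
Qed.

(** A hyperbolic plane contributes 1 / ((1 - t) (1 + t)): the recursion gives
    S_(k+2)(1, -1, s) = S_k(1, -1, s) + S_(k+1)(-1, s) + S_(k+2)(-1, s), and the
    last two terms add up to S_(k+2)(s), since S_(k+1)(-1, s) cancels against
    its negative. *)
Lemma sympow_hyperbolic s k : all (fun c => c != 0) s ->
  sympow (H ++ s) k ~h> div_sq (sympow s) k.
Proof.
move=> s0; pose u := -1 :: s.
have u0 : all (fun c => c != 0) u by rewrite /= oppr_eq0 oner_neq0.
have opp i : sympow u i ++ dscale (-1) (sympow u i) ~h> [::].
  exact/hchain_opp/sympow_nz.
have step i : sympow u i ++ sympow u i.+1 ~h> sympow s i.+1.
  rewrite sympowS catA -[X in _ ~h> X]cat0s; exact: hchain_cat.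
apply: div_sqE => {k} [||k] //; rewrite -[H ++ s]/(1 :: u).
- by rewrite !sympow0.
- apply: hchain_trans (step 0%N); rewrite sympowS dscale1 !sympow0.
  exact: hchain_refl.
rewrite sympowS dscale1 sympowS dscale1 -catA.
apply: hchain_trans (hchain_cat (hchain_refl _) (step k.+1)) _.
by apply/chain_hchain/chain_perm; perm_cat_tac.
Qed.

Lemma sympow_dcopies_hyperbolic m s k : all (fun c => c != 0) s ->
  sympow (dcopies m H ++ s) k ~h> iter m div_sq (sympow s) k.
Proof.
move=> s0; elim: m k => [|m IHm] k; first exact: hchain_refl.
rewrite -[dcopies m.+1 H ++ s]/(H ++ (dcopies m H ++ s)).
apply: hchain_trans (sympow_hyperbolic _ _) _; last exact: eq_div_sq.
rewrite all_cat s0 andbT; elim: (m) => //= i ->.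
by rewrite oppr_eq0 !oner_neq0.
Qed.

(** The binomial series of (1 - t^2)^(-M), multiplied by X t + Y t^3. *)
Lemma iter_div_sq_odd f X Y M i :
  f 1%N ~h> X -> f 3 ~h> Y -> (forall j, f j.*2.+1.+4 ~h> [::]) ->
  iter M div_sq f i.*2.+1 ~h> dcopies 'C(M + i - 1, i) X ++
    dcopies (if i is j.+1 then 'C(M + j - 1, j) else 0) Y.
Proof.
move=> f1 f3 f5; elim: M i => [|M IHM].
  case=> [|[|j]] /=.
  - by rewrite /dcopies /= !cats0.
  - by rewrite /dcopies /= cats0.
  - by rewrite !add0n !subn1 !bin_small //; apply: f5.
elim=> [|i IHi].
  by have := IHM 0%N; rewrite !bin0.
rewrite doubleS [iter M.+1 _ _ _]/=.
apply: hchain_trans (hchain_cat (IHM i.+1) IHi) _.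
apply/chain_hchain/chain_perm.
have -> : 'C(M.+1 + i.+1 - 1, i.+1) =
    ('C(M + i.+1 - 1, i.+1) + 'C(M.+1 + i - 1, i))%N.
  by rewrite !addSn !addnS !subn1 /= binS.
have -> : 'C(M.+1 + i - 1, i) =
    ('C(M + i - 1, i) + (if i is j.+1 then 'C(M.+1 + j - 1, j) else 0))%N.
  by case: (i) => [|j]; rewrite ?bin0 // !addSn !addnS !subn1 /= binS.
by rewrite !dcopiesD; perm_cat_tac.
Qed.

End Hyperbolic.

Notation "s ~h> t" := (hchain s t).

(** * Four-dimensional forms with square determinant up to sign *)

Section FourDim.
Variable K : fieldType.
Hypothesis two_neq0 : 2%:R != 0 :> K.
Variables (n a b e : K).
Hypotheses (n0 : n != 0) (a0 : a != 0) (b0 : b != 0) (e2 : e ^+ 2 = 1).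
Let q := dscale n [:: 1; a; b; e * a * b].

Let e0 : e != 0.
Proof.
by apply: contraTneq (oner_neq0 K) => e0; rewrite -e2 e0 expr0n eqxx.
Qed.

(** The product of all four entries of q is e modulo squares, so omitting one
    entry from it multiplies the entry by e. *)
Lemma extpow_quaternionic :
  [/\ extpow q 1 ~h> q, extpow q 3 ~h> dscale e q &
      forall j, extpow q j.*2.+1.+4 ~h> [::]].
Proof.
rewrite /extpow /q /=; split=> /=; last by move=> j; apply/hchain_refl.
- rewrite !mulr1; apply/chain_hchain/chain_perm.
  rewrite -[[:: n; _; _; _]]/(rev [:: n * (e * a * b); n * b; n * a; n]).
  by rewrite perm_sym perm_rev.
- apply: chain_hchain; rewrite !mulr1.
  have E1 : n * a * (n * b * (n * (e * a * b))) = e * n * (n * a * b) ^+ 2.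
    by ring.
  have E2 : n * (n * b * (n * (e * a * b))) = e * (n * a) * (n * b) ^+ 2.
    by ring.
  have E3 : n * (n * a * (n * (e * a * b))) = e * (n * b) * (n * a) ^+ 2.
    by ring.
  have E4 : n * (n * a * (n * b)) = e * (n * (e * a * b)) * n ^+ 2.
    by transitivity (e ^+ 2 * (n * (n * a * (n * b)))); [rewrite e2|]; ring.
  rewrite E1 E2 E3 E4.
  by do !(apply: ChainCons; first by rewrite ?mulf_neq0); apply: ChainRefl.
Qed.

(** The odd part of the generating function of the symmetric powers is
    (q t + e q t^3) / (1 - t^2)^(m + 4) modulo hyperbolic planes. *)
Lemma sympow_quaternionic m i :
  sympow (dcopies m (hyperbolic_plane K) ++ q) i.*2.+1 ~h>
  dcopies 'C(m + i + 3, i) q ++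
  dcopies (if i is j.+1 then 'C(m + j + 3, j) else 0) (dscale e q).
Proof.
have q0 : all (fun c => c != 0) q by rewrite /= !mulf_neq0 ?oner_neq0.
have [q1 q3 q5] := extpow_quaternionic.
apply: hchain_trans (sympow_dcopies_hyperbolic two_neq0 _ _ q0) _.
have h k := sympow_extpow two_neq0 k q0.
apply: hchain_trans (eq_iter_div_sq m h _) _.
rewrite -iterD.
have E j : (m + 4 + j - 1 = m + j + 3)%N by lia.
have := iter_div_sq_odd (m + 4) i q1 q3 q5; rewrite E.
by case: (i) => [|j] //; rewrite E.
Qed.

End FourDim.

Section FourDimOdd.
Variable K : fieldType.
Hypothesis two_neq0 : 2%:R != 0 :> K.
Variables (n a b : K) (m j : nat).
Hypotheses (n0 : n != 0) (a0 : a != 0) (b0 : b != 0).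
Let k := j.+1.*2.+1.
Let H := hyperbolic_plane K.

(* Here j = (k - 3) / 2 and 2 (j + 1) = k - 1. *)
Let coefE r X : (r * 'C(m + j + 3, j) = (2 * j.+1) * X)%N ->
  mult_coef r m k = X.
Proof.
have -> : (m + j + 3 = (2 * m + k + 3)./2)%N by rewrite /k; lia.
have -> : (2 * j.+1 = k - 1)%N by rewrite /k; lia.
rewrite -[in 'C(_, j)](_ : (k - 3)./2 = j)%N; last by rewrite /k; lia.
by rewrite /mult_coef => ->; rewrite mulKn // /k; lia.
Qed.

Lemma mult_coef0 : mult_coef (2 * m + 2 * k + 4) m k =
  ('C(m + j.+1 + 3, j.+1) + 'C(m + j + 3, j))%N.
Proof.
apply: coefE; have := mul_bin_diag (m + j + 3).+1 j.
rewrite (_ : (m + j.+1 + 3 = (m + j + 3).+1)%N); last by lia.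
rewrite [_.+1.-1]/= => E.
by rewrite mulnDr -[(2 * _ * 'C(_.+1, _))%N]mulnA -E /k; lia.
Qed.

Lemma mult_coef2 : mult_coef (2 * m + 6) m k = 'C(m + j + 3, j.+1).
Proof.
apply: coefE; have := mul_bin_left (m + j + 3) j.
rewrite (_ : (m + j + 3 - j = m + 3)%N); last by lia.
by move=> E; rewrite -mulnA E; lia.
Qed.

Lemma sympow_odd_plus :
  let q := dscale n [:: 1; a; b; a * b] in
  sympow (dcopies m H ++ q) k ~h> dcopies (mult_coef (2 * m + 2 * k + 4) m k) q.
Proof.
have := sympow_quaternionic two_neq0 n0 a0 b0 (expr1n _ 2) m j.+1.
by rewrite !mul1r dscale1 -dcopiesD mult_coef0.
Qed.

(** Here the copies of - q cancel against as many copies of q, and Pascal's rule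
    counts what is left. *)
Lemma sympow_odd_minus :
  let q := dscale n [:: 1; a; b; -1 * a * b] in
  sympow (dcopies m H ++ q) k ~h> dcopies (mult_coef (2 * m + 6) m k) q.
Proof.
have m1 : (-1) ^+ 2 = 1 :> K by rewrite sqrrN expr1n.
move=> q.
apply: hchain_trans (sympow_quaternionic two_neq0 n0 a0 b0 m1 m j.+1) _.
rewrite -/q mult_coef2 -dscale_dcopies.
rewrite (_ : (m + j.+1 + 3 = (m + j + 3).+1)%N); last by lia.
rewrite binS dcopiesD -catA -[X in hchain _ X]cats0.
apply: hchain_cat; first exact: hchain_refl.
apply: hchain_opp => //; elim: 'C(_, _) => //= i ->.
by rewrite !mulf_neq0 ?oppr_eq0 ?oner_neq0.
Qed.

End FourDimOdd.

(** * Orthogonal bases from an involution *)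

Section OrthFree.
Variables (K : fieldType) (V : vectType K) (B : V -> V -> K).
Hypothesis B_sym : forall u v, B u v = B v u.
Hypothesis B_lin : forall k u v w, B (k *: u + v) w = k * B u w + B v w.

Lemma orth_free es : orth B es -> free es.
Proof.
elim: es => [|e es IHes]; first by rewrite nil_free.
rewrite orth_cons free_cons => /and3P[qe0 ees /IHes->]; rewrite andbT.
apply: contra qe0 => e_in; apply/eqP.
have B0 : B e 0 = 0 by rewrite -(scale0r 0) (bilZr B_sym B_lin) mul0r.
rewrite [X in B e X](coord_span (X := in_tuple es) e_in).
rewrite (big_morph (B e) (bilDr B_sym B_lin e) B0) big1 // => i _.
by rewrite (bilZr B_sym B_lin) (eqP (allP ees _ (mem_nth _ _))) ?mulr0.
Qed.

End OrthFree.

(** A family v such that v i pairs nontrivially with v (sig i) only: the fixed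
    points of the involution sig are mutually orthogonal, and any other orbit
    spans a hyperbolic plane. *)
Section Involution.
Variables (K : fieldType) (V : lmodType K) (B : V -> V -> K).
Hypothesis two_neq0 : 2%:R != 0 :> K.
Hypothesis B_sym : forall u v, B u v = B v u.
Hypothesis B_lin : forall k u v w, B (k *: u + v) w = k * B u w + B v w.
Variables (I : finType) (sig : I -> I) (v : I -> V).
Hypothesis sigK : involutive sig.
Let beta i := B (v i) (v (sig i)).
Hypothesis B_v0 : forall i j, j != sig i -> B (v i) (v j) = 0.
Hypothesis beta_neq0 : forall i, beta i != 0.

(* An orbit {i, j} of size two with i before j, in an arbitrary order, yields
   v i + c v j, of value 1, at the index i and v i - c v j, of value -1, at the
   index j, where c is the inverse of twice the pairing of v i and v j. *)
Let lt i := (enum_rank i < enum_rank (sig i))%N.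
Let c i := (2%:R * beta i)^-1.
Let s_ i := if (sig i == i) || lt i then 1 else - c i.
Let t_ i := if sig i == i then 0 else if lt i then c i else 1.
Let e i := s_ i *: v i + t_ i *: v (sig i).

Let beta_sig i : beta (sig i) = beta i.
Proof. by rewrite /beta sigK B_sym. Qed.

Let B_vE i j : B (v i) (v j) = beta i *+ (j == sig i).
Proof. by case: eqVneq => [->|/B_v0]. Qed.

Let B_e i j : B (e i) (e j) =
  beta i * ((s_ i * s_ j + t_ i * t_ j) *+ (j == sig i)
            + (s_ i * t_ j + t_ i * s_ j) *+ (i == j)).
Proof.
rewrite /e !(bilDl B_lin, bilDr B_sym B_lin) !(bilZl B_lin, bilZr B_sym B_lin).
rewrite !B_vE sigK beta_sig (inj_eq (can_inj sigK)).
rewrite [j == i]eq_sym [sig j == i](can2_eq sigK sigK).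
by case: (i == j); case: (j == sig i); rewrite /= ?mulr0n ?mulr1n; ring.
Qed.

Let lt_sig i : sig i != i -> lt (sig i) = ~~ lt i.
Proof.
move=> ni; rewrite /lt sigK -leqNgt [RHS]leq_eqVlt.
by rewrite (inj_eq (@ord_inj _)) (inj_eq enum_rank_inj) (negPf ni).
Qed.

Let gam i := if sig i == i then beta i else if lt i then 1 else -1.

Let B_eE i j : B (e i) (e j) = gam i *+ (i == j).
Proof.
have cE k : 2%:R * beta k * c k = 1 by rewrite mulfV // mulf_neq0.
rewrite B_e /gam; have [<-{j}|ij] := eqVneq i j.
  rewrite /s_ /t_ [i == _]eq_sym; case: eqVneq => /= [_|_].
    by rewrite !(mulr0, mulr1, addr0).
  by case: ifP => _; rewrite mulr0n add0r ?mulr1 ?mul1r ?mulr1n;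
    rewrite -(cE i); ring.
rewrite /= mulr0n addr0; case: eqVneq => [jE|_]; last by rewrite mulr0.
move: ij; rewrite {}jE eq_sym => ni.
rewrite /s_ /t_ sigK [i == sig i]eq_sym (negPf ni) /=.
rewrite lt_sig // /c beta_sig.
by case: (lt i) => /=; rewrite mulr1n; ring.
Qed.

Lemma nseq_hyperbolic p :
  perm_eq (nseq p 1 ++ nseq p (-1)) (dcopies p (hyperbolic_plane K)).
Proof.
elim: p => //= p IHp; rewrite /dcopies /= perm_cons -/(dcopies _ _).
apply: perm_trans (permEl (perm_catCA (nseq p 1) [:: _] _)) _.
by rewrite /= perm_cons.
Qed.

Lemma orth_of_involution : exists fs : seq V, exists h : nat,
  [/\ orth B fs, size fs = #|I| &
      perm_eq [seq B u u | u <- fs]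
        ([seq B (v i) (v i) | i <- enum I & sig i == i]
         ++ dcopies h (hyperbolic_plane K))].
Proof.
(* The number of hyperbolic planes is the number of orbits of size two. *)
exists (map e (enum I)), #|[pred i | (sig i != i) && lt i]|; split.
- have gam0 i : gam i != 0.
    rewrite /gam; case: ifP => _; first exact: beta_neq0.
    by case: ifP => _; rewrite ?oppr_eq0 oner_neq0.
  apply/andP; split; last first.
    by rewrite all_map; apply/allP => i _ /=; rewrite B_eE eqxx mulr1n.
  rewrite pairwise_map; have := enum_uniq I; rewrite uniq_pairwise.
  by apply: sub_pairwise => i j /= ij; rewrite B_eE (negPf ij).
- by rewrite size_map -cardE.
rewrite -map_comp (eq_map (g := gam)); last first.
  by move=> i /=; rewrite B_eE eqxx mulr1n.
rewrite -(permPl (perm_map gam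
  (permEl (perm_filterC (fun i => sig i == i) (enum I))))) map_cat.
have -> : [seq gam i | i <- enum I & sig i == i] =
    [seq B (v i) (v i) | i <- enum I & sig i == i].
  apply/eq_in_map => i; rewrite mem_filter /gam => /andP[/eqP si _].
  by rewrite si eqxx /beta si.
rewrite perm_cat2l; set r := filter (predC _) _.
rewrite -(permPl (perm_map gam (permEl (perm_filterC lt r)))) map_cat.
have gam1 : [seq gam i | i <- r & lt i] = nseq (size (filter lt r)) 1.
  rewrite -(size_map gam); apply/all_pred1P/allP => _ /mapP[i + ->] /=.
  rewrite !mem_filter /gam.
  by case/and3P=> -> /= /negPf-> _.
have gamN1 : [seq gam i | i <- r & predC lt i] =
    nseq (size (filter (predC lt) r)) (-1).
  rewrite -(size_map gam); apply/all_pred1P/allP => _ /mapP[i + ->] /=.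
  rewrite !mem_filter /gam.
  by case/and3P=> /= /negPf-> /negPf-> _.
have sizeE (P Q : pred I) :
    size (filter P (filter Q (enum I))) = #|[predI P & Q]|.
  by rewrite -filter_predI size_filter -sum1_count big_enum_cond -sum1_card.
rewrite gam1 gamN1 !sizeE.
rewrite [X in nseq X (-1)](_ : _ = #|[predI lt & predC (fun i => sig i == i)]|).
  rewrite [X in dcopies X](_ : _ = #|[predI lt & predC (fun i => sig i == i)]|).
    exact: nseq_hyperbolic.
  by apply: eq_card => i; rewrite !inE andbC.
(* The involution exchanges the first and the second elements of the orbits. *)
rewrite -[RHS](card_image (can_inj sigK)); apply: eq_card => i.
apply/idP/imageP => [|[j + ->]]; rewrite !inE /=.
  case/andP=> nlt ni; exists (sig i); rewrite ?sigK // !inE /= sigK eq_sym ni.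
  by have -> : (sig i \in lt) = lt (sig i) by []; rewrite lt_sig ?nlt.
by case/andP=> jlt nj; rewrite lt_sig // negbK sigK eq_sym nj andbT.
Qed.

End Involution.

(** * The trace form of a symbol algebra *)

Section SymbolAlgebra.
Variables (K : fieldType) (a b w : K) (N : nat) (S : falgType K) (x y : S).
Let n := N.+1.
Hypotheses (w_prim : n.-primitive_root w) (a0 : a != 0) (b0 : b != 0).
Hypotheses (xn : x ^+ n = a%:A) (yn : y ^+ n = b%:A).
Hypothesis yx : y * x = w *: (x * y).
Hypothesis gen : agenv <<[:: x; y]>> = fullv.

Definition mon i j := x ^+ i * y ^+ j.

Let yxX i : y * x ^+ i = w ^+ i *: (x ^+ i * y).
Proof.
elim: i => [|i IHi]; first by rewrite !expr0 mulr1 mul1r scale1r.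
rewrite !exprS mulrA yx -scalerAl -[x * y * _]mulrA IHi -scalerAr scalerA.
by rewrite mulrA.
Qed.

Let yXx j : y ^+ j * x = w ^+ j *: (x * y ^+ j).
Proof.
elim: j => [|j IHj]; first by rewrite !expr0 mulr1 mul1r scale1r.
rewrite [y ^+ j.+1]exprS -mulrA IHj -scalerAr [y * (x * _)]mulrA yx -scalerAl.
by rewrite scalerA -exprSr -mulrA.
Qed.

Lemma yXxX i j : y ^+ j * x ^+ i = w ^+ (i * j) *: (x ^+ i * y ^+ j).
Proof.
elim: j => [|j IHj]; first by rewrite muln0 !expr0 mulr1 mul1r scale1r.
rewrite [y ^+ j.+1]exprS -mulrA IHj -scalerAr [y * (_ * _)]mulrA yxX -scalerAl.
by rewrite scalerA -exprD -mulrA mulnS addnC.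
Qed.

Lemma monM i j i' j' :
  mon i j * mon i' j' = w ^+ (i' * j) *: mon (i + i') (j + j').
Proof.
rewrite /mon -mulrA [y ^+ j * _]mulrA yXxX -scalerAl -scalerAr.
by rewrite !exprD !mulrA.
Qed.

Lemma mon_mod i j : mon i j =
  (a ^+ (i %/ n) * b ^+ (j %/ n)) *: mon (i %% n) (j %% n).
Proof.
have X (z : S) c m : z ^+ n = c%:A -> z ^+ m = c ^+ (m %/ n) *: z ^+ (m %% n).
  move=> zn; rewrite {1}(divn_eq m n) exprD mulnC exprM zn.
  by rewrite exprZn expr1n -scalerAl mul1r.
by rewrite /mon (X _ _ _ xn) (X _ _ _ yn) -scalerAl -scalerAr scalerA.
Qed.

Let I : finType := ('I_n * 'I_n)%type.
Let v (i : I) := mon i.1 i.2.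

(** The relations bring every word in x and y to the form x^i y^j with
    exponents below n. *)
Lemma span_mon : (<<map v (enum I)>> = fullv)%VS.
Proof.
set E := <<_>>%VS; apply/eqP; rewrite eqEsubv subvf /= -gen.
have monE i j : mon i j \in E.
  rewrite mon_mod memvZ // memv_span //; apply/mapP.
  by exists (inord (i %% n), inord (j %% n)); rewrite ?mem_enum // /v /=
     !inordK // ltn_pmod.
apply: agenv_sub_modl.
  by rewrite -memvE; have := monE 0%N 0%N; rewrite /mon !expr0 mulr1.
apply/prodvP => u z; rewrite span_cons span_seq1.
case/memv_addP=> _ /vlineP[k ->] [_ /vlineP[l ->] ->] zE.
rewrite mulrDl -!scalerAl.
suff H : (x * z \in E) && (y * z \in E).
  by rewrite rpredD // memvZ //; case/andP: H.
rewrite (coord_span (X := in_tuple _) zE) !mulr_sumr.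
apply/andP; split; apply: rpred_sum => i _; rewrite -scalerAr memvZ //;
  have /mapP[p _ ->] := mem_nth 0 (ltn_ord i); rewrite /v /mon.
- by rewrite mulrA -exprS monE.
- by rewrite mulrA yxX -scalerAl memvZ // -mulrA -exprS monE.
Qed.

Variables (Trd : S -> K).
Hypothesis Trd_lin : forall k u z, Trd (k *: u + z) = k * Trd u + Trd z.
Hypothesis Trd_comm : forall u z, Trd (u * z) = Trd (z * u).
Hypothesis Trd_neq0 : exists z, Trd z != 0.

Lemma TrdZ k u : Trd (k *: u) = k * Trd u.
Proof.
have T0 : Trd 0 = 0.
  by have := Trd_lin (-1) 0 0; rewrite scaler0 addr0 mulN1r addNr.
by rewrite -[k *: u]addr0 Trd_lin T0 addr0.
Qed.

(** Conjugation by y multiplies x^i y^j by w^i, and conjugation by x multiplies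
    it by w^(-j), while the trace does not change. *)
Lemma Trd_mon0 i j : ~~ ((n %| i) && (n %| j))%N -> Trd (mon i j) = 0.
Proof.
have fin c t (r : K) : r * c * t = c * t -> r != 1 -> c != 0 -> t = 0.
  move=> E r1 c0; apply/eqP; have : (r - 1) * (c * t) == 0.
    by rewrite mulrBl mulrA E mul1r subrr.
  by rewrite !mulf_eq0 subr_eq0 (negPf r1) (negPf c0).
rewrite negb_and !(prim_order_dvd w_prim) => /orP[wi|wj].
  have E1 : y * (mon i j * y ^+ N) = (w ^+ i * b) *: mon i j.
    rewrite /mon -mulrA [y * _]mulrA yxX -scalerAl -mulrA -exprD -exprS -addnS.
    by rewrite exprD yn mulr_algr -scalerAr scalerA.
  have E2 : mon i j * y ^+ N * y = b *: mon i j.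
    by rewrite -mulrA -exprSr yn mulr_algr.
  by have := Trd_comm y (mon i j * y ^+ N); rewrite E1 E2 !TrdZ => /fin->.
have E1 : x ^+ N * mon i j * x = (w ^+ j * a) *: mon i j.
  rewrite /mon -!mulrA yXx -!scalerAr !mulrA -exprD -exprSr -addSn.
  by rewrite exprD xn mulr_algl -!scalerAl scalerA.
have E2 : x * (x ^+ N * mon i j) = a *: mon i j.
  by rewrite mulrA -exprS xn mulr_algl.
by have := Trd_comm (x ^+ N * mon i j) x; rewrite E1 E2 !TrdZ => /fin->.
Qed.

Lemma Trd_mon i j : (n %| i)%N -> (n %| j)%N ->
  Trd (mon i j) = a ^+ (i %/ n) * b ^+ (j %/ n) * Trd 1.
Proof.
move=> /eqP ni /eqP nj; rewrite mon_mod ni nj TrdZ /mon !expr0 mulr1.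
by [].
Qed.

(** Otherwise the trace would vanish on all monomials. *)
Lemma Trd1_neq0 : Trd 1 != 0.
Proof.
case: Trd_neq0 => z; apply: contraNneq => T1.
have : z \in <<map v (enum I)>>%VS by rewrite span_mon memvf.
move/(coord_span (X := in_tuple _)) => ->.
elim/big_ind: _ => [|u t /eqP Tu /eqP Tt|i _].
- by rewrite -(scale0r 0) TrdZ mul0r.
- by rewrite -[u]scale1r Trd_lin Tu Tt mulr0 addr0.
have /mapP[p _ ->] := mem_nth 0 (ltn_ord i); rewrite TrdZ.
case: (boolP ((n %| p.1) && (n %| p.2))%N) => [/andP[p1 p2]|/Trd_mon0->].
  by rewrite Trd_mon // T1 !mulr0.
by rewrite mulr0.
Qed.

Let B u z := Trd (u * z).

Let B_sym u z : B u z = B z u.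
Proof. exact: Trd_comm. Qed.

Let B_lin k u z t : B (k *: u + z) t = k * B u t + B z t.
Proof. by rewrite /B mulrDl -scalerAl Trd_lin. Qed.

Let dvd_add (i j : 'I_n) : (n %| i + j)%N = (j == - i).
Proof.
rewrite -addr_eq0 addrC -val_eqE /=; exact.
Qed.

Let B_v0 i j : j != - i -> B (v i) (v j) = 0.
Proof.
move=> ij; rewrite /B monM TrdZ Trd_mon0 ?mulr0 // !dvd_add.
apply: contra ij => /andP[/eqP h1 /eqP h2].
by rewrite [j]surjective_pairing h1 h2.
Qed.

Let B_vV i : B (v i) (v (- i)) != 0.
Proof.
rewrite /B monM TrdZ Trd_mon ?dvd_add //.
have w0 : w != 0.
  apply/eqP => w0; have := prim_expr_order w_prim.
  by move/eqP; rewrite w0 expr0n eq_sym oner_eq0.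
by rewrite !mulf_neq0 ?expf_neq0 // Trd1_neq0.
Qed.

Hypothesis two_neq0 : 2%:R != 0 :> K.
Hypothesis n_even : ~~ odd n.
Let h := (n %/ 2)%N.
Let nE : n = (h * 2)%N.
Proof. by rewrite /h divnK // dvdn2. Qed.

Let h_lt : (h < n)%N.
Proof. by rewrite nE; move: nE; case: (h) => // h' _; lia. Qed.

Let h_gt0 : (0 < h)%N.
Proof. by move: nE; case: (h). Qed.

Let wh : w ^+ h = -1.
Proof.
have : (w ^+ h) ^+ 2 == 1 by rewrite -exprM -nE prim_expr_order.
rewrite sqrf_eq1 => /orP[|/eqP//]; rewrite -(prim_order_dvd w_prim).
by rewrite gtnNdvd.
Qed.

Let fixed_coord (i : 'I_n) : (- i == i) = (i == 0) || (i == inord h).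
Proof.
rewrite eq_sym -dvd_add -!val_eqE /= inordK // addnn -muln2 {1}nE.
rewrite dvdn_pmul2r //; apply/idP/orP => [|[/eqP->|/eqP->]] //.
case/dvdnP=> c ic; have : (c < 2)%N.
  have := ltn_ord i; rewrite {2}nE ic mulnC -/n; rewrite ltn_pmul2l //.
by case: c ic => [|[|c]] // ->; [left|right]; rewrite ?mul1n.
Qed.

Let hh : 'I_n := inord h.
Let fixed : seq I := [:: (0, 0); (hh, 0); (0, hh); (hh, hh)].

Let fixed_perm : perm_eq [seq i <- enum I | - i == i] fixed.
Proof.
have hh0 : hh != 0 by rewrite -val_eqE /= inordK // -lt0n.
apply: uniq_perm.
- by rewrite filter_uniq ?enum_uniq.
- by rewrite /= !inE !xpair_eqE !eqxx [0 == hh]eq_sym (negPf hh0).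
move=> [i j]; rewrite mem_filter mem_enum andbT !inE !xpair_eqE !fixed_coord.
by do 4![case: (_ == _)].
Qed.

(** The monomial x^i y^j pairs nontrivially with x^(-i) y^(-j) only, exponents
    being taken modulo n.  With h = n / 2, the self-paired monomials are 1, x^h,
    y^h and x^h y^h, of squares 1, a, b and w^(h h) a b = (-1)^h a b. *)
Lemma symbol_orth : exists (fs : seq S) (m : nat),
  [/\ orth (fun u z => Trd (u * z)) fs, size fs = (n * n)%N &
      perm_eq [seq Trd (u * u) | u <- fs]
        (dscale (Trd 1) [:: 1; a; b; (-1) ^+ h * a * b]
         ++ dcopies m (hyperbolic_plane K))].
Proof.
have [fs [m [ofs sz pe]]] := @orth_of_involution _ _ B two_neq0 B_sym B_lin
  I (@GRing.opp I) v opprK B_v0 B_vV.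
exists fs, m; split=> //; first by rewrite sz card_prod card_ord.
apply: perm_trans pe _; rewrite perm_cat2r.
apply: perm_trans (perm_map _ fixed_perm) _.
have E i j : B (mon (h * i) (h * j)) (mon (h * i) (h * j)) =
    (-1) ^+ (h * i * j) * a ^+ i * b ^+ j * Trd 1.
  have D k : (h * k + h * k = k * n)%N by rewrite nE; lia.
  rewrite /B monM TrdZ !D Trd_mon ?dvdn_mull // !mulnK //.
  by rewrite [(h * i * _)%N]mulnCA exprM wh !mulrA.
rewrite /fixed /= /v /= inordK //.
have := E 0%N 0%N; have := E 0%N 1%N; have := E 1%N 0%N; have := E 1%N 1%N.
rewrite !(muln0, muln1, mul0n) => -> -> -> ->.
by rewrite !(expr0, expr1, mul1r, mulr1) ![_ * Trd 1]mulrC.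
Qed.

(** The monomials span, and an orthogonal system of the same size is free. *)
Lemma symbol_dim : \dim {:S} = (n * n)%N.
Proof.
apply/eqP; rewrite eqn_leq; apply/andP; split.
  rewrite -span_mon; apply: leq_trans (dim_span _) _.
  by rewrite size_map -cardE card_prod card_ord.
have [fs [m [ofs <- _]]] := symbol_orth.
have /eqP <- := orth_free B_sym B_lin ofs.
exact/dimvS/subvf.
Qed.

End SymbolAlgebra.

(** * Conclusion *)

(** Over a splitting field the reduced trace is the trace of d x d matrices; it
    does not vanish identically because a basis of the algebra becomes a basis
    of the matrices, and some matrix has trace 1. *)
Lemma reduced_traceP (K : fieldType) (A : falgType K) (Trd : A -> K) :
  is_reduced_trace Trd ->
  [/\ forall k u z, Trd (k *: u + z) = k * Trd u + Trd z,
      forall u z, Trd (u * z) = Trd (z * u),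
      exists z, Trd z != 0
    & exists2 d, Trd 1 = d%:R & (d * d)%N = \dim {:A}].
Proof.
case=> L [iota [d [phi [[phiZ phi_basis] TrdE]]]].
have dd : (d * d)%N = \dim {:A}.
  have := size_basis (X := in_tuple _) phi_basis.
  by rewrite dimvf /dim /= size_map size_tuple.
split.
- move=> k u z; apply: (fmorph_inj iota).
  by rewrite rmorphD rmorphM !TrdE rmorphD phiZ mxtraceD mxtraceZ.
- by move=> u z; apply: (fmorph_inj iota); rewrite !TrdE !rmorphM mxtrace_mulC.
- have [/hasP[z _ z0]|tr0] := boolP (has (fun z => Trd z != 0) (vbasis {:A})).
    by exists z.
  have d_gt0 : (0 < d)%N by have := adim_gt0 {:A}; rewrite -dd muln_gt0 andbb.
  have trM0 (M : 'M[L]_d) : \tr M = 0.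
    have /andP[/eqP Mspan _] := phi_basis.
    have : M \in <<in_tuple [seq phi z | z <- vbasis {:A}]>>%VS.
      by rewrite Mspan memvf.
    move/coord_span->; rewrite raddf_sum big1 // => i _; rewrite [LHS]mxtraceZ.
    have /mapP[z z_in ->] := mem_nth 0 (ltn_ord i).
    move/hasPn: tr0 => /(_ z z_in); rewrite negbK => /eqP z0.
    by rewrite -TrdE z0 rmorph0 mulr0.
  have := trM0 (delta_mx (Ordinal d_gt0) (Ordinal d_gt0)).
  rewrite /mxtrace (bigD1 (Ordinal d_gt0)) //= big1 => [|i i0].
    by rewrite mxE !eqxx addr0 => /eqP; rewrite oner_eq0.
  by rewrite mxE (negPf i0).
exists d => //; apply: (fmorph_inj iota).
by rewrite TrdE rmorph1 mxtrace1 rmorph_nat.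
Qed.

Theorem proposition4p3 (n : nat) (K : fieldType) (w a b : K)
    (S : falgType K) (Trd : S -> K) (k : nat) (W : vectType K) (psi : W -> K) :
  (0 < n)%N -> ~~ odd n ->
  2%N \notin [pchar K] ->
  n.-primitive_root w ->
  a != 0 -> b != 0 ->
  is_symbol_algebra a b n w S ->
  is_reduced_trace Trd ->
  odd k -> (1 < k)%N ->
  is_sym_power k (trace_form Trd) psi ->
  let m := ((n ^ 2 - 4) %/ 2)%N in
  let q := dscale n%:R [:: 1; a; b; (-1) ^+ (n %/ 2) * a * b] in
  let is_copies_plus_Hyp (r : nat) := exists h : nat,
    let rhs := dcopies r q ++ dcopies h (hyperbolic_plane K) in
    size rhs = 'C(n ^ 2 + k - 1, k) /\ isometric psi (@diag_form K rhs) in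
  (n = 0 %[mod 4] -> is_copies_plus_Hyp (mult_coef (2 * m + 2 * k + 4) m k)) /\
  (n = 2 %[mod 4] -> is_copies_plus_Hyp (mult_coef (2 * m + 6) m k)).
Proof.
case: n => // N _ n_even ch w_prim a0 b0 [x [y [xn yn yx gen]]] TrdP.
move=> k_odd k_gt1.
case=> s [s0 phi_s psi_s].
have two_neq0 : 2%:R != 0 :> K by move: ch; rewrite inE.
have [Trd_lin Trd_comm Trd_nz [d Td dd]] := reduced_traceP TrdP.
have dimS := symbol_dim w_prim a0 b0 xn yn yx gen Trd_lin Trd_comm Trd_nz
  two_neq0 n_even.
have d_n : d = N.+1.
  by apply/eqP; rewrite -(eqn_exp2r _ _ (isT : 0 < 2)%N) -!mulnn dd dimS.
have [fs [m' [ofs sz_fs fs_q]]] := symbol_orth w_prim a0 b0 xn yn yx gen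
  Trd_lin Trd_comm Trd_nz two_neq0 n_even.
move=> m q is_rhs; rewrite Td d_n -/q in fs_q.
have mE : m' = m.
  have := perm_size fs_q.
  rewrite size_map sz_fs size_cat size_dcopies /= /m -mulnn.
  by clear => E; rewrite E addKn mulnK.
rewrite {}mE in fs_q.
have sz_s : size s = (N.+1 ^ 2)%N by rewrite (isometric_dim phi_s) dimS mulnn.
have s_q : s ~~> dcopies m (hyperbolic_plane K) ++ q.
  apply: ChainTrans (chain_of_orth_basis two_neq0
    (B := fun u z => Trd (u * z)) Trd_comm _ phi_s s0 ofs _) _.
  - by move=> c u v z; rewrite mulrDl -scalerAl Trd_lin.
  - by rewrite sz_fs sz_s mulnn.
  by apply: chain_perm; rewrite (permPl fs_q) perm_catC.
have final r :
    sympow (dcopies m (hyperbolic_plane K) ++ q) k ~h> dcopies r q -> is_rhs r.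
  case=> h hP; exists h => rhs.
  have s_rhs : dsym_power k s ~~> rhs.
    apply: ChainTrans (chain_perm (dsym_power_sympow k s)) _.
    exact: ChainTrans (sympow_chain k s_q) hP.
  split; first by rewrite -(chain_size s_rhs) size_dsym_power sz_s.
  exact: isometric_trans psi_s (chain_isometric s_rhs).
have [j kE] : exists j, k = j.+1.*2.+1.
  by clear -k_odd k_gt1; exists k./2.-1; lia.
have n0 : N.+1%:R != 0 :> K := prim_root_natf_neq0 w_prim.
split=> n_mod; apply: final; rewrite kE.
  have odd_h : odd (N.+1 %/ 2) = false by clear -n_mod; lia.
  have := sympow_odd_plus two_neq0 m j n0 a0 b0.
  by rewrite /q -signr_odd odd_h expr0 mul1r.
have odd_h : odd (N.+1 %/ 2) by clear -n_mod; lia.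
have := sympow_odd_minus two_neq0 m j n0 a0 b0.
by rewrite /q -signr_odd odd_h expr1.
Qed.
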